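(* Let $\tau_0>0$ be fixed (independent of $E$). For almost all $\underline{E}$, $$\lim_{t\uparrow\infty}\lim_{E\downarrow-\infty}\mathbb{P}_E(x_E(t)=x_j)=\frac{\tau_j}{\sum_{k=1}^\infty\tau_k}\qquad\forall j=1,2,\dots,$$ implying $$\lim_{t_w\uparrow\infty}\lim_{E\downarrow-\infty}\Pi_E(\theta t_w,t_w)=0\qquad\forall\theta>0,$$ $$\lim_{t_w\uparrow\infty}\lim_{E\downarrow-\infty}\Pi_E(t,t_w)=\frac{\sum_{i=1}^\infty\tau_ie^{-x_it}}{\sum_{i=1}^\infty\tau_i}\qquad\forall t>0.$$
   Context: Fix $0<\alpha<1$. Let $\sum_i\delta_{E_i}$ be a Poisson point process on $\mathbb{R}$ with intensity measure $\alpha e^{-\alpha E}\,dE$; almost surely its support is infinite and bounded above, and its points are labelled in decreasing order $E_1>E_2>\cdots$; write $\underline{E}=(E_1,E_2,\dots)$. For $E\in\mathbb{R}$ let $N_E=\max\{i:E_i\ge E\}$ (so a.s. $1\le N_E<\infty$ for all sufficiently small $E$). Given a time unit $\tau_0>0$, set $x_i:=\tau_0e^{-E_i}$ and $\tau_i:=x_i^{-1}$ (almost surely $\sum_i\tau_i<\infty$). Given $\underline{E}$, let $Y_E(t)$, $t\ge0$, be the continuous-time Markov chain on $\{1,\dots,N_E\}$ with jump rate $x_i/N_E$ from $i$ to $j$ for every $j\neq i$, started from the uniform distribution; $\mathbb{P}_E$ denotes its law for given $\underline{E}$. Set $x_E(t):=x_k$ if $Y_E(t)=k$, and $$\Pi_E(t,t_w):=\mathbb{P}_E\big(Y_E(s)=Y_E(t_w)\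 \ \forall s\in[t_w,t_w+t]\big).$$ *)

(* Defs.v *)
From HB Require Import structures.
From mathcomp Require Import all_boot all_order all_algebra.
From mathcomp Require Import all_classical all_reals all_analysis.
From mathcomp Require Import measurable_realfun.

Set Implicit Arguments.
Unset Strict Implicit.
Unset Printing Implicit Defensive.

Import Order.TTheory GRing.Theory Num.Theory.
Import numFieldNormedType.Exports.

Local Open Scope classical_set_scope.
Local Open Scope ring_scope.

Definition mutually_independent {d} {T : measurableType d} {R : realType}
    (P : probability T R) (n : nat) (X : 'I_n -> T -> \bar R) : Prop :=
  forall A : 'I_n -> set (\bar R), (forall k, measurable (A k)) ->
    P [set w | forall k, A k (X k w)] = (\prod_(k < n) P (X k @^-1` A k))%E.

Definition point_count {R : realType} (e : nat -> R) (B : set R) : \bar R :=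
  (\sum_(0 <= i <oo) \d_(e i) B)%E.

(* The second argument of [poisson_prob] is a dummy.  [poisson_pmf] would be
   wrong here: at rate 0 it is 1 at every integer, whereas [poisson_prob] is
   then the Dirac mass at 0. *)
Definition is_poisson_process {d} {T : measurableType d} {R : realType}
    (P : probability T R) (mu : set R -> \bar R) (E : nat -> T -> R) : Prop :=
  let N (B : set R) (w : T) := point_count (fun i => E i w) B in
  [/\ forall (B : set R) (n : nat), measurable B -> (mu B < +oo)%E ->
        P [set w | N B w = n%:R%:E] = poisson_prob (fine (mu B)) 0 [set n],
      forall B : set R, measurable B -> mu B = +oo%E ->
        P [set w | N B w = +oo%E] = 1%E
    & forall (n : nat) (B : 'I_n -> set R),
        (forall k, measurable (B k)) -> trivIset setT B ->
        mutually_independent P (fun k => N (B k))].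

Definition energy_intensity {R : realType} (alpha : R) (B : set R) : \bar R :=
  (\int[lebesgue_measure]_(x in B) (alpha * expR (- alpha * x))%:E)%E.

(* Transition function of a Markov chain on a finite set with jump rates [q]:
   p_h(i,j) = q(i,j) h + o(h) as h decreases to 0, for j != i. *)
Definition is_transition_function {R : realType} {S : finType}
    (q : S -> S -> R) (p : R -> S -> S -> R) : Prop :=
  [/\ forall (t : R) i j, 0 <= t -> 0 <= p t i j,
      forall (t : R) i, 0 <= t -> \sum_j p t i j = 1,
      forall i j, p 0 i j = (i == j)%:R,
      forall (s t : R) i j, 0 <= s -> 0 <= t ->
        p (s + t) i j = \sum_k p s i k * p t k j
    & forall i j, i != j -> p h i j / h @[h --> 0^'+] --> q i j].

Definition is_markov_chain {d} {T : measurableType d} {R : realType}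
    (P : probability T R) {S : finType} (init : S -> R) (q : S -> S -> R)
    (Y : R -> T -> S) : Prop :=
  [/\ forall (t : R) i, 0 <= t -> measurable (Y t @^-1` [set i]),
      forall w (t : R), 0 <= t -> \forall s \near t^'+, Y s w = Y t w
    & exists2 p, is_transition_function q p &
        forall (n : nat) (t : nat -> R) (s : nat -> S),
          t 0%N = 0 -> nondecreasing_seq t ->
          P [set w | forall k, (k <= n)%N -> Y (t k) w = s k] =
          (init (s 0%N) *
            \prod_(k < n) p (t k.+1 - t k) (s k) (s k.+1))%:E].

(* Points are numbered from 0: [e i] is E_(i+1), and likewise for x and tau. *)
Definition trap_rate {R : realType} (tau0 : R) (e : nat -> R) (i : nat) : R :=
  tau0 * expR (- e i).

Definition trap_time {R : realType} (tau0 : R) (e : nat -> R) (i : nat) : R :=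
  (trap_rate tau0 e i)^-1.

(* N_L = max {i >= 1 : E_i >= L}, and 0 if this set is empty or unbounded. *)
Definition num_traps {R : realType} (e : nat -> R) (L : R) : nat :=
  supremum 0%N [set i.+1 | i in [set i | L <= e i]].

(* State k stands for the label k+1.  For N_L > 0 this is 'I_(N_L), i.e. the
   labels 1,...,N_L.  For N_L = 0 it is a singleton rather than empty, so that a
   process with values in it exists for every L. *)
Notation trap e L := 'I_(num_traps e L).-1.+1.

Definition is_trap_chain {d} {T : measurableType d} {R : realType}
    (P : probability T R) (tau0 : R) (e : nat -> R) (L : R)
    (Y : R -> T -> trap e L) : Prop :=
  let n : R := (num_traps e L)%:R in
  is_markov_chain P (fun=> #|{: trap e L}|%:R^-1)
    (fun i _ : trap e L => trap_rate tau0 e i / n) Y.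

Definition depth_prob {d} {T : measurableType d} {R : realType}
    (P : probability T R) (tau0 : R) (e : nat -> R) (L : R)
    (Y : R -> T -> trap e L) (j : nat) (t : R) : R :=
  fine (P [set w | trap_rate tau0 e (Y t w) = trap_rate tau0 e j]).

Definition no_jump_prob {d} {T : measurableType d} {R : realType}
    (P : probability T R) (S : Type) (Y : R -> T -> S) (t tw : R) : R :=
  fine (P [set w | forall s, tw <= s <= tw + t -> Y s w = Y tw w]).

(* lim_(t -> +oo) lim_(L -> -oo) f L t = l, the inner limit existing for every
   time t >= 0. *)
Definition iterated_limit {R : realType} (f : R -> R -> R) (l : R) : Prop :=
  exists2 g : R -> R,
    forall t : R, 0 <= t -> f L t @[L --> -oo] --> g t
    & g t @[t --> +oo] --> l.

(* Main.v *)
Require Import Defs.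
From HB Require Import structures.
From mathcomp Require Import all_boot all_order all_algebra.
From mathcomp Require Import all_classical all_reals all_analysis.
From mathcomp Require Import measurable_realfun.
From mathcomp Require Import ring lra.

Set Implicit Arguments.
Unset Strict Implicit.
Unset Printing Implicit Defensive.

Import Order.TTheory GRing.Theory Num.Theory.
Import numFieldNormedType.Exports.

Local Open Scope classical_set_scope.
Local Open Scope ring_scope.

(** Fix the depths, and consider the chain on the [n] deepest traps.  Let [p i t] be the
    probability of being in trap [i] at time [t], from the uniform start.  The new trap
    is chosen uniformly, independently of the trap that is left, so the forward equation
    is  p_i' = u - x_i p_i  with the same entrance rate  u = (1/n) sum_k x_k p_k  for
    every [i].  Everything about the marginals follows from this system of equations.

    Relaxation.  For two solutions [a], [b] of such a system the sum over [l] of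
    x_l a_l(r + s) b_l(r - s) does not depend on [s], which is how reversibility shows
    up here.  With a = b = p it gives  u(2r) = sum_l x_l p_l(r)^2,  and the
    Cauchy-Schwarz inequality bounds this below by  1 / S_n,  where S_n is the sum of
    the first [n] times tau_l.  By Duhamel's formula p_l(t) is then at least
    (tau_l / S_n) (1 - e^(- x_l t)); as the p_l sum to one, p_l(t) is within e^(- x_0 t)
    of its equilibrium value tau_l / S_n ([flow_equilibrium]), uniformly in [n].

    Existence of the limit.  Let V be the primitive of u with V(0) = 1/n, and W_i the
    expected time spent in trap [i] before time [t]; thus p_i = V - x_i W_i.  Both V and
    W_i decrease when [n] increases ([renewal_le], [occupation_le]): the chain on [n]
    traps is the chain on [m >= n] traps with the time spent in the additional traps cut
    out.  Analytically, the gap between two systems obeys the same equations with an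
    additional source term, and pairing it with [p] through the above identity gives the
    sign.  Being monotone and nonnegative they converge, hence so does p_i ([flow_is_cvg]).
    The uniform relaxation bound passes to the limit and yields the first claim.

    Jumps.  The holding times are exponential, so the probability of staying put during
    [tw, tw + t] is  sum_i p_i(tw) e^(- x_i (1 - 1/n) t)  ([no_jump_probE], by dyadic
    discretisation of time and right-continuity).  The tail of this sum from rank [K] on
    is at most e^(- x_K t / 2) whatever the weights p_i are, so both limits can be taken
    term by term ([cvg_truncation]).

    Environment.  All this needs almost surely finite S = sum_i tau_i.  By Markov's
    inequality the probability that [2 ^ k] points lie above [- a k] is at most
    (e^(alpha a) / 2)^k, which is summable if alpha a < log 2; and Cauchy condensation
    makes the sum of e^(E_i) finite as soon as  E_(2^k) < - a k  eventually and
    a > log 2.  For alpha < 1 both conditions on [a] can be met. *)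

(** * Real functions of one variable *)

Section calculus.
Context {R : realType}.

Lemma is_derive_ext (f g : R -> R) (t a b : R) :
  f =1 g -> a = b -> is_derive t 1 f a -> is_derive t 1 g b.
Proof. by move=> /funext-> ->. Qed.

Lemma is_derive_sum_ord (n : nat) (f : nat -> R -> R) (df : nat -> R) (t : R) :
  (forall i, (i < n)%N -> is_derive t 1 (f i) (df i)) ->
  is_derive t 1 (fun s => \sum_(i < n) f i s) (\sum_(i < n) df i).
Proof.
move=> fdf; apply: (@is_derive_ext (\sum_(i < n) f i)) => //.
  by move=> s; rewrite fct_sumE.
by apply: is_derive_sum => i; exact: fdf.
Qed.

Lemma is_derive_shiftl (f : R -> R) (c t df : R) :
  is_derive (c + t) 1 f df -> is_derive t 1 (fun s => f (c + s)) df.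
Proof.
move=> fdf; have h : is_derive t 1 (fun s : R => c + s) 1.
  have := is_deriveD (is_derive_cst c t (1 : R)) (is_derive_id t (1 : R)).
  by apply: is_derive_ext => //; rewrite add0r.
by have := @is_derive1_comp R f _ t df 1 fdf h; rewrite mulr1.
Qed.

Lemma is_derive_reflect (f : R -> R) (c t df : R) :
  is_derive (c - t) 1 f df -> is_derive t 1 (fun s => f (c - s)) (- df).
Proof.
move=> fdf; have h : is_derive t 1 (fun s : R => c - s) (-1).
  have := is_deriveB (is_derive_cst c t (1 : R)) (is_derive_id t (1 : R)).
  by apply: is_derive_ext => //; rewrite sub0r.
by have := @is_derive1_comp R f _ t df (-1) fdf h; rewrite mulrN1.
Qed.

Lemma is_derive_mul (f g : R -> R) (t df dg : R) :
  is_derive t 1 f df -> is_derive t 1 g dg ->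
  is_derive t 1 (fun s => f s * g s) (f t * dg + g t * df).
Proof. by move=> fdf gdg; have := is_deriveM fdf gdg. Qed.

Lemma is_derive_mull (f : R -> R) (c t df : R) :
  is_derive t 1 f df -> is_derive t 1 (fun s => c * f s) (c * df).
Proof. by move=> fdf; have := is_deriveZ c fdf. Qed.

Lemma continuous_sum_ord (n : nat) (f : nat -> R -> R) :
  (forall i, (i < n)%N -> continuous (f i)) ->
  continuous (fun s => \sum_(i < n) f i s).
Proof.
move=> fc s; apply: cvg_big => [|i _]; last exact: fc.
exact: add_continuous.
Qed.

Lemma ge0_derive_le (f df : R -> R) (a b : R) : a <= b -> continuous f ->
  (forall t, a < t < b -> is_derive t 1 f (df t)) ->
  (forall t, a < t < b -> 0 <= df t) -> f a <= f b.
Proof.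
move=> ab fc fdf df0; rewrite le_eqVlt in ab.
case/predU1P: ab => [->//|ab].
have fdf' t : t \in `]a, b[%R -> is_derive t 1 f (df t).
  by rewrite in_itv; exact: fdf.
have [c] := MVT ab fdf' (continuous_subspaceT fc).
rewrite in_itv => cab /eqP; rewrite subr_eq => /eqP ->.
by rewrite lerDr mulr_ge0 ?df0// subr_ge0 ltW.
Qed.

Lemma continuous_shiftl (f : R -> R) (c : R) :
  continuous f -> continuous (fun s => f (c + s)).
Proof.
move=> fc s; apply: (@continuous_comp _ _ _ (fun s => c + s) f); last exact: fc.
by apply: continuousD; [exact: cvg_cst|exact: cvg_id].
Qed.

Lemma continuous_reflect (f : R -> R) (c : R) :
  continuous f -> continuous (fun s => f (c - s)).
Proof.
move=> fc s; apply: (@continuous_comp _ _ _ (fun s => c - s) f); last exact: fc.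
by apply: continuousB; [exact: cvg_cst|exact: cvg_id].
Qed.

Lemma continuous_mul (f g : R -> R) :
  continuous f -> continuous g -> continuous (fun s => f s * g s).
Proof. by move=> fc gc s; exact: cvgM (fc s) (gc s). Qed.

Lemma continuous_mull (f : R -> R) (c : R) :
  continuous f -> continuous (fun s => c * f s).
Proof. by apply: continuous_mul => s; exact: cvg_cst. Qed.

(** The product of [f] and the integrating factor [expR (r * t)] is nondecreasing. *)
Lemma ge0_derive_decay_le (f df : R -> R) (r T : R) : 0 <= T -> continuous f ->
  (forall t, 0 < t < T -> is_derive t 1 f (df t)) ->
  (forall t, 0 < t < T -> 0 <= df t + r * f t) -> f 0 * expR (- (r * T)) <= f T.
Proof.
move=> T0 fc fdf df0.
pose F t := expR (r * t) * f t.
have ed (t : R) : is_derive t 1 (fun s : R => expR (r * s)) (r * expR (r * t)).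
  have h : is_derive t 1 (fun s : R => r * s) (r * 1) by exact: is_derive_mull.
  by have := @is_derive1_comp R expR _ t _ _ (is_derive_expR _) h; rewrite mulr1 mulrC.
have : F 0 <= F T.
  apply: (@ge0_derive_le F (fun t => expR (r * t) * (df t + r * f t))) => //.
  - apply: continuous_mul => // s.
    apply: (@continuous_comp _ _ _ (fun s => r * s) expR).
      by apply: continuous_mull => u; exact: cvg_id.
    exact: continuous_expR.
  - move=> t tT; have := is_derive_mul (ed t) (fdf t tT).
    apply: is_derive_ext => //; ring.
  - by move=> t tT; rewrite mulr_ge0 ?expR_ge0 ?df0.
rewrite /F mulr0 expR0 mul1r expRN => h.
by rewrite ler_pdivrMr ?expR_gt0// mulrC.
Qed.

End calculus.

Section powers.
Context {R : realType}.

Lemma cvg_dyadic_step (t : R) : t / (2 ^ k)%:R @[k --> \oo] --> (0 : R).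
Proof.
rewrite -[X in _ --> X](mulr0 t); apply: cvgMl_tmp.
have -> : (fun k => (2 ^ k)%:R^-1) = (fun k => 2^-1 ^+ k) :> (nat -> R).
  by apply/funext => k; rewrite natrX exprVn.
by apply: cvg_expr; rewrite ger0_norm// invf_lt1// ltr1n.
Qed.

(** [1 + z] lies between [expR (z / (1 + z))] and [expR z], and both bounds, raised to
    the power [2 ^ k], have the same limit. *)
Lemma cvg_pow_dyadic (f : R -> R) (r t : R) : 0 < t -> f h @[h --> 0^'+] --> (1 : R) ->
  (f h - 1) / h @[h --> 0^'+] --> - r ->
  f (t / (2 ^ k)%:R) ^+ (2 ^ k) @[k --> \oo] --> expR (- (r * t)).
Proof.
move=> t0 f1 fr.
pose u (k : nat) : R := t / (2 ^ k)%:R.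
have p0 k : 0 < (2 ^ k)%:R :> R by rewrite ltr0n expn_gt0.
have u0 k : 0 < u k by rewrite divr_gt0.
have uc : u k @[k --> \oo] --> (0 : R) by exact: cvg_dyadic_step.
have fu : f (u k) @[k --> \oo] --> (1 : R) by move/cvg_at_rightP : f1; apply.
have gu : (f (u k) - 1) / u k @[k --> \oo] --> - r by move/cvg_at_rightP : fr; apply.
pose z k := f (u k) - 1.
have Nz : (2 ^ k)%:R * z k @[k --> \oo] --> - (r * t).
  have h : (f (u k) - 1) / u k * t @[k --> \oo] --> - r * t by exact: cvgMr_tmp.
  rewrite -mulNr.
  apply: cvg_trans h; apply: near_eq_cvg; near=> k.
  by rewrite /z /u; field; rewrite !gt_eqF.
have Nz' : (2 ^ k)%:R * z k / f (u k) @[k --> \oo] --> - (r * t).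
  rewrite -[X in _ --> X]divr1; apply: cvgM => //; apply: cvgV => //; exact: oner_neq0.
have ce (v : nat -> R) l : v k @[k --> \oo] --> l -> expR (v k) @[k --> \oo] --> expR l.
  by move=> vl; apply: (@cvg_comp _ _ _ v expR _ _ _ vl); exact: continuous_expR.
apply: squeeze_cvgr (ce _ _ Nz') (ce _ _ Nz).
near=> k.
have fk : 0 < f (u k) by near: k; exact: (cvgr_gt _ fu _ ltr01).
apply/andP; split.
  rewrite -mulrA expRM_natl lerXn2r ?nnegrE ?expR_ge0 ?(ltW fk)//.
  have := expR_ge1Dx (- (z k / f (u k))).
  have -> : 1 + - (z k / f (u k)) = (f (u k))^-1 by rewrite /z; field; rewrite gt_eqF.
  by rewrite expRN lef_pV2// ?posrE ?expR_gt0.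
rewrite expRM_natl lerXn2r ?nnegrE ?expR_ge0 ?(ltW fk)//.
by have := expR_ge1Dx (z k); rewrite /z subrKC.
Unshelve. all: by end_near. Qed.

End powers.

Section limits.
Context {R : realType}.

Lemma nondecreasing_is_cvgNy (f : R -> R) (L0 : R) :
  (forall a b, a <= b -> b <= L0 -> f a <= f b) ->
  (forall a, a <= L0 -> 0 <= f a) -> cvg (f a @[a --> -oo]).
Proof.
move=> fmono f0; pose g r := - f (Num.min (- r) L0).
have gmono : {homo g : r s / r <= s}.
  move=> r s rs; rewrite lerN2; apply: fmono; last by rewrite ge_min lexx orbT.
  by rewrite le_min !ge_min lexx !orbT lerN2 rs.
have gub : has_ubound (range g).
  by exists 0 => _ [r _ <-]; rewrite oppr_le0 f0// ge_min lexx orbT.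
have gc := nondecreasing_cvgr gmono gub.
apply/cvg_ex; exists (- sup (range g)); apply/cvgNy_compNP.
apply: cvg_trans (cvgN gc); apply: near_eq_cvg; near=> r.
by rewrite /= /g opprK min_l// lerNl; near: r; apply: nbhs_pinfty_ge; exact: num_real.
Unshelve. all: by end_near. Qed.

(** Truncation errors that are uniform along [F] make [s] Cauchy, and identify its limit
    with that of the termwise limits [sigma]. *)
Lemma cvg_truncation {T : Type} {F : set_system T} {FF : ProperFilter F}
    (s : T -> R) (S : T -> nat -> R) (sigma eta : nat -> R) :
  (forall K, \forall a \near F, `|s a - S a K| <= eta K) ->
  (forall K, S a K @[a --> F] --> sigma K) ->
  eta K @[K --> \oo] --> 0 ->
  cvgn sigma /\ s a @[a --> F] --> limn sigma.
Proof.
move=> sS Ssigma eta0.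
have sc : cvg (s a @[a --> F]).
  apply/cauchy_cvgP/cauchy_exP => e e0.
  have e2 : 0 < e / 2 by rewrite divr_gt0.
  have [K _ /(_ K (leqnn _)) hK] := cvgr_lt _ eta0 _ e2.
  exists (sigma K); suff : \forall a \near F, ball (sigma K) e (s a) by [].
  near=> a.
  have h1 : `|s a - S a K| <= eta K by near: a; exact: sS.
  have h2 : `|sigma K - S a K| < e / 2.
    by near: a; move/cvgrPdist_lt : (Ssigma K); apply.
  rewrite /ball/= (_ : sigma K - s a = (sigma K - S a K) - (s a - S a K)); last by ring.
  apply: le_lt_trans (ler_normB _ _) _.
  by rewrite [e]splitr ltr_leD// ltW// (le_lt_trans h1).
have {}sc : s a @[a --> F] --> lim (s a @[a --> F]) by [].
set l := lim _ in sc.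
have sl : sigma K @[K --> \oo] --> l.
  apply/cvgrPdist_le => e e0; near=> K.
  have hK : eta K <= e by near: K; exact: (cvgr_le _ eta0 _ e0).
  apply: le_trans hK.
  have h : `|s a - S a K| @[a --> F] --> `|l - sigma K|.
    by apply: cvg_norm; apply: cvgB => //; exact: Ssigma.
  by apply: (cvgr_to_le h); exact: sS.
by split; [apply/cvg_ex; exists l|rewrite (cvg_lim _ sl)].
Unshelve. all: by end_near. Qed.

(** Weights of total mass at most one cannot make up for a small integrand: the bound does
    not depend on [b]. *)
Lemma weighted_tail (b c : nat -> R) (e : R) K M : (forall i, 0 <= b i) ->
  (forall k, \sum_(i < k) b i <= 1) -> (forall i, (K <= i)%N -> 0 <= c i <= e) ->
  (K <= M)%N -> `|\sum_(i < M) b i * c i - \sum_(i < K) b i * c i| <= e.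
Proof.
move=> b0 b1 ce KM.
have e0 : 0 <= e by have /andP[] := ce K (leqnn K); exact: le_trans.
rewrite -!(big_mkord xpredT (fun i => b i * c i)) (big_cat_nat (leq0n K) KM)//=.
rewrite addrAC subrr add0r ger0_norm; last first.
  rewrite big_nat_cond; apply: sumr_ge0 => i /andP[/andP[Ki _] _].
  by have /andP[c0 _] := ce i Ki; rewrite mulr_ge0.
apply: (@le_trans _ _ (\sum_(K <= i < M) b i * e)).
  rewrite big_nat_cond [leRHS]big_nat_cond; apply: ler_sum => i /andP[/andP[Ki _] _].
  by have /andP[_ ?] := ce i Ki; rewrite ler_wpM2l.
rewrite -mulr_suml ler_piMl//; apply: le_trans (b1 M).
rewrite -(big_mkord xpredT b) [leRHS](big_cat_nat (leq0n K) KM)//= lerDr.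
exact: sumr_ge0.
Qed.

Lemma cvg_expR_decay (c : R) : 0 < c -> expR (- (c * t)) @[t --> +oo] --> (0 : R).
Proof.
move=> c0; apply: (@cvg_comp _ _ _ (fun t => c * t) (fun z => expR (- z)) _
  (pinfty_nbhs R)).
  exact: gt0_cvgMry.
exact: cvgr_expR.
Qed.

End limits.

(** * The forward equations of the trap model *)

Section trap_flow.
Context {R : realType}.
Implicit Types (i j n m : nat) (s t T : R).

(** The rate at which each single trap is entered: a trap is left for a uniformly chosen
    one, so that this rate is the same for all traps. *)
Definition flux (x : nat -> R) (n : nat) (p : nat -> R -> R) (t : R) : R :=
  n%:R^-1 * \sum_(i < n) x i * p i t.

(** The marginal laws, as functions of time, of the chain on the first [n] traps.  They
    are required to be continuous on the whole line, which avoids one-sided statements at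
    time [0], and to vanish beyond rank [n], so that chains of different sizes can be
    compared and summed over the same indices. *)
Record trap_flow (x : nat -> R) (n : nat) (p : nat -> R -> R) : Prop := {
  flow_continuous : forall i, continuous (p i);
  flow_derive : forall i (t : R), (i < n)%N -> 0 < t ->
    is_derive t 1 (p i) (flux x n p t - x i * p i t);
  flow_init : forall i, (i < n)%N -> p i 0 = n%:R^-1;
  flow_ge0 : forall i (t : R), 0 <= p i t;
  flow_sum : forall t : R, 0 <= t -> \sum_(i < n) p i t = 1;
  flow_out : forall i (t : R), (n <= i)%N -> p i t = 0 }.

Context (x : nat -> R) (x_gt0 : forall i, 0 < x i).

Definition partition_sum (n : nat) : R := \sum_(i < n) (x i)^-1.

Lemma partition_sum_gt0 n : (0 < n)%N -> 0 < partition_sum n.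
Proof.
case: n => // n _; rewrite /partition_sum big_ord_recl ltr_wpDr ?invr_gt0//.
by apply: sumr_ge0 => i _; rewrite invr_ge0 ltW.
Qed.

Lemma sum_flux n (p : nat -> R -> R) (t : R) : (0 < n)%N ->
  \sum_(i < n) x i * p i t = n%:R * flux x n p t.
Proof. by move=> n0; rewrite /flux mulrA mulfV ?mul1r// pnatr_eq0 -lt0n. Qed.

Section one_flow.
Context (n : nat) (p : nat -> R -> R) (n_gt0 : (0 < n)%N).
Hypothesis pF : trap_flow x n p.

Let pc i : continuous (p i).
Proof. exact: (flow_continuous pF). Qed.

(** Reversibility in the form [flux (2 r) = sum_l x_l p_l(r)^2], obtained by moving [s]
    from [0] to [r] in the constant function [h], followed by Cauchy-Schwarz. *)
Lemma flux_ge t : 0 < t -> (partition_sum n)^-1 <= flux x n p t.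
Proof.
move=> t0; set S := partition_sum n; pose r := t / 2.
have r0 : 0 < r by rewrite divr_gt0.
have S0 : 0 < S by exact: partition_sum_gt0.
pose h s := \sum_(l < n) x l * (p l (r + s) * p l (r - s)).
have hle : h 0 <= h r.
  apply: (@ge0_derive_le R h (fun=> 0)) => //; first exact: ltW.
    apply: (@continuous_sum_ord R n
      (fun l s => x l * (p l (r + s) * p l (r - s)))) => i _; apply: continuous_mull.
    apply: continuous_mul; first exact: continuous_shiftl.
    exact: continuous_reflect.
  move=> s /andP[s0 sr].
  have rs : 0 < r + s by rewrite addr_gt0.
  have rs' : 0 < r - s by rewrite subr_gt0.
  set U := flux x n p (r + s); set W := flux x n p (r - s).
  pose dh l := x l * (p l (r + s) * - (W - x l * p l (r - s)) +
                      p l (r - s) * (U - x l * p l (r + s))).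
  have <- : \sum_(l < n) dh l = 0.
    transitivity (\sum_(l < n) (- W * (x l * p l (r + s)) + U * (x l * p l (r - s)))).
      by apply: eq_bigr => i _; rewrite /dh; ring.
    rewrite big_split/= -!mulr_sumr !sum_flux// -/U -/W; ring.
  apply: (@is_derive_sum_ord R n (fun l s => x l * (p l (r + s) * p l (r - s)))).
  move=> i lin; apply: is_derive_mull; apply: is_derive_mul.
    exact: is_derive_shiftl (flow_derive pF lin rs).
  exact: is_derive_reflect (flow_derive pF lin rs').
have -> : flux x n p t = h r.
  rewrite /h /flux mulr_sumr; apply: eq_bigr => i _.
  by rewrite subrr (flow_init pF)// /r -splitr mulrA mulrC.
apply: le_trans hle.
(* Cauchy-Schwarz through the tangents: x a^2 >= 2 c a - c^2 / x with c = 1 / S. *)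
have -> : S^-1 = \sum_(l < n) (2 * S^-1 * p l r - S^-1 ^+ 2 * (x l)^-1).
  rewrite sumrB -!mulr_sumr (flow_sum pF) ?ltW// -/(partition_sum n) -/S.
  by field; rewrite gt_eqF.
apply: ler_sum => i _; rewrite addr0 subr0 -subr_ge0.
have -> : x i * (p i r * p i r) - (2 * S^-1 * p i r - S^-1 ^+ 2 * (x i)^-1) =
    (x i)^-1 * (x i * p i r - S^-1) ^+ 2.
  by field; rewrite !gt_eqF.
by rewrite mulr_ge0 ?sqr_ge0// invr_ge0 ltW.
Qed.

(** Duhamel's formula with the entrance rate replaced by its lower bound. *)
Lemma flow_ge i t : (i < n)%N -> 0 <= t ->
  (x i)^-1 / partition_sum n * (1 - expR (- (x i * t))) <= p i t.
Proof.
move=> lin t0; set S := partition_sum n; set c := _ / S.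
have S0 : 0 < S by exact: partition_sum_gt0.
have c0 : 0 <= c by rewrite divr_ge0// ?invr_ge0 ltW.
have : (p i 0 - c) * expR (- (x i * t)) <= p i t - c.
  apply: (@ge0_derive_decay_le R (fun s => p i s - c)
    (fun s => flux x n p s - x i * p i s)) => //.
  - by move=> s; apply: cvgB; [exact: pc|exact: cvg_cst].
  - move=> s /andP[s0 _].
    have := is_deriveB (flow_derive pF lin s0) (is_derive_cst c s (1 : R)).
    by apply: is_derive_ext => //; rewrite subr0.
  - move=> s /andP[s0 _].
    have -> : flux x n p s - x i * p i s + x i * (p i s - c) = flux x n p s - S^-1.
      by rewrite /c; field; rewrite !gt_eqF.
    by rewrite subr_ge0 flux_ge.
have : 0 <= p i 0 * expR (- (x i * t)).
  by rewrite mulr_ge0 ?expR_ge0// (flow_ge0 pF).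
nra.
Qed.

(** The lower bounds of [flow_ge] sum to at least [1 - expR (- (x 0 * t))], which leaves
    little room above them.  The bound does not depend on [n]. *)
Lemma flow_equilibrium i t : (forall k, x 0%N <= x k) -> (i < n)%N -> 0 <= t ->
  `|p i t - (x i)^-1 / partition_sum n| <= expR (- (x 0%N * t)).
Proof.
move=> xmin lin t0; set S := partition_sum n.
have S0 : 0 < S by exact: partition_sum_gt0.
have lo (k : 'I_n) : (x k)^-1 / S - (x k)^-1 / S * expR (- (x 0%N * t)) <= p k t.
  apply: le_trans (flow_ge (ltn_ord k) t0).
  rewrite -/S mulrBr mulr1 lerB// ler_wpM2l//.
    by rewrite divr_ge0// ?invr_ge0 ltW.
  by rewrite ler_expR lerN2 ler_wpM2r.
have e0 := expR_ge0 (- (x 0%N * t)).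
have pi1 : \sum_(k < n) (x k)^-1 / S = 1 by rewrite -mulr_suml divff ?gt_eqF.
have pi0 (k : 'I_n) : 0 <= (x k)^-1 / S by rewrite divr_ge0// ?invr_ge0 ltW.
have psum := flow_sum pF t0.
rewrite (bigD1 (Ordinal lin))//= in pi1; rewrite (bigD1 (Ordinal lin))//= in psum.
have : \sum_(k < n | k != Ordinal lin)
     ((x k)^-1 / S - (x k)^-1 / S * expR (- (x 0%N * t)))
   <= \sum_(k < n | k != Ordinal lin) p k t by apply: ler_sum => k _.
rewrite sumrB -[X in _ - X <= _]mulr_suml.
have sum0 : 0 <= \sum_(k < n | k != Ordinal lin) (x k)^-1 / S by exact: sumr_ge0.
move: (lo (Ordinal lin)) (pi0 (Ordinal lin)) sum0 pi1 psum => /=.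
move: (\sum_(k < n | _) _) (\sum_(k < n | _) _) e0 => A B.
move: (expR _) ((x i)^-1 / S) (p i t) => e a q e0 h1 h2 h3 h4 h5 h6.
rewrite ler_norml; apply/andP; split; nra.
Qed.

(** The primitive of [flux] with value [1 / n] at time [0]: the expected number of entrances
    into a given trap up to time [t], the initial state being counted as an entrance.
    The closed form comes from summing the forward equations with weights [1 / x i]. *)
Definition renewal t : R := (t + \sum_(i < n) (x i)^-1 * p i t) / partition_sum n.

(** The expected time spent in trap [i] up to time [t], in closed form: it is the primitive
    of [p i] which vanishes at [0]. *)
Definition occupation i t : R := (x i)^-1 * (renewal t - p i t).

Let S0 : 0 < partition_sum n. Proof. exact: partition_sum_gt0. Qed.

Lemma continuous_renewal : continuous renewal.
Proof.
move=> t; apply: cvgMr_tmp; apply: cvgD; first exact: cvg_id.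
apply: (@continuous_sum_ord R n (fun i t => (x i)^-1 * p i t)) => i _.
exact: continuous_mull.
Qed.

Lemma continuous_occupation i : continuous (occupation i).
Proof.
apply: continuous_mull => t.
by apply: cvgB; [exact: continuous_renewal|exact: pc].
Qed.

Lemma is_derive_renewal t : 0 < t -> is_derive t 1 renewal (flux x n p t).
Proof.
move=> t0; set S := partition_sum n.
have h : is_derive t 1 (fun t => \sum_(i < n) (x i)^-1 * p i t)
    (\sum_(i < n) (x i)^-1 * (flux x n p t - x i * p i t)).
  apply: (@is_derive_sum_ord R n (fun i t => (x i)^-1 * p i t)
    (fun i => (x i)^-1 * (flux x n p t - x i * p i t))) => i lin.
  exact: is_derive_mull (flow_derive pF lin t0).
have := is_derive_mull S^-1 (is_deriveD (is_derive_id t (1 : R)) h).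
apply: is_derive_ext => [s|]; first by rewrite /renewal mulrC.
have -> : \sum_(i < n) (x i)^-1 * (flux x n p t - x i * p i t) =
    S * flux x n p t - 1.
  rewrite -(flow_sum pF (ltW t0)) mulr_suml -sumrB; apply: eq_bigr => i _.
  by field; rewrite gt_eqF.
by field; rewrite gt_eqF.
Qed.

Lemma is_derive_occupation i t : (i < n)%N -> 0 < t ->
  is_derive t 1 (occupation i) (p i t).
Proof.
move=> lin t0.
have := is_derive_mull (x i)^-1
  (is_deriveB (is_derive_renewal t0) (flow_derive pF lin t0)).
by apply: is_derive_ext => //; field; rewrite gt_eqF.
Qed.

Lemma renewal0 : renewal 0 = n%:R^-1.
Proof.
rewrite /renewal add0r.
under eq_bigr => i _ do rewrite (flow_init pF)//.
by rewrite -mulr_suml mulrAC divff ?mul1r// gt_eqF.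
Qed.

Lemma occupation0 i : (i < n)%N -> occupation i 0 = 0.
Proof. by move=> lin; rewrite /occupation renewal0 (flow_init pF)// subrr mulr0. Qed.

Lemma renewal_occupation i t : renewal t = p i t + x i * occupation i t.
Proof. by rewrite /occupation; field; rewrite gt_eqF. Qed.

Lemma renewal_ge0 t : 0 <= t -> 0 <= renewal t.
Proof.
move=> t0; rewrite divr_ge0 ?addr_ge0 ?(ltW S0)//.
by apply: sumr_ge0 => i _; rewrite mulr_ge0 ?invr_ge0 ?(ltW (x_gt0 _))// (flow_ge0 pF).
Qed.

Lemma occupation_ge0 i t : (i < n)%N -> 0 <= t -> 0 <= occupation i t.
Proof.
move=> lin t0; rewrite -[leLHS](occupation0 lin).
apply: (ge0_derive_le t0 (@continuous_occupation i)) => s /andP[s0 _].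
  exact: is_derive_occupation.
exact: (flow_ge0 pF).
Qed.

End one_flow.

Section two_flows.
Context (n m : nat) (p q : nat -> R -> R) (n_gt0 : (0 < n)%N) (nm : (n <= m)%N).
Hypothesis pF : trap_flow x n p.
Hypothesis qF : trap_flow x m q.

Let D i t := occupation n p i t - occupation m q i t.
Let G t := renewal n p t - renewal m q t.

Let m_gt0 : (0 < m)%N. Proof. exact: leq_trans nm. Qed.

Let GE i t : G t = p i t - q i t + x i * D i t.
Proof. by rewrite /G /D (renewal_occupation n p i) (renewal_occupation m q i); ring. Qed.

Let D0 i : (i < n)%N -> D i 0 = 0.
Proof.
move=> lin; rewrite /D (occupation0 n_gt0 pF lin) (occupation0 m_gt0 qF) ?subrr//.
exact: leq_trans nm.
Qed.

Let Dc i : continuous (D i).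
Proof. by move=> t; apply: cvgB; apply: continuous_occupation. Qed.

Let dD i t : (i < n)%N -> 0 < t -> is_derive t 1 (D i) (p i t - q i t).
Proof.
move=> lin t0; apply: is_deriveB; apply: is_derive_occupation => //.
exact: leq_trans nm.
Qed.

(** The traps of rank at least [n] only have mass in the larger system. *)
Let missing_mass t : 0 <= t -> 0 <= \sum_(i < n) (p i t - q i t).
Proof.
move=> t0; rewrite sumrB subr_ge0 (flow_sum pF t0) -(flow_sum qF t0).
rewrite -!(big_mkord xpredT (fun i => q i t)) (big_cat_nat (leq0n n) nm)//= lerDl.
by apply: sumr_ge0 => i _; rewrite (flow_ge0 qF).
Qed.

Let flux_ge0 t : 0 <= flux x n p t.
Proof.
rewrite mulr_ge0 ?invr_ge0//; apply: sumr_ge0 => i _.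
by rewrite mulr_ge0 ?(ltW (x_gt0 _))// (flow_ge0 pF).
Qed.

(** Pairing the gap [D] with the time-reversed flow [p (t - s)], weighted by [x]: the terms
    linear in [D] cancel by reversibility, and what remains is [missing_mass]. *)
Let weighted_gap_ge0 t : 0 <= t -> 0 <= \sum_(i < n) x i * D i t.
Proof.
move=> t0.
pose h s := \sum_(l < n) x l * (D l s * p l (t - s)).
have hle : h 0 <= h t.
  apply: (@ge0_derive_le R h
     (fun s => flux x n p (t - s) * \sum_(l < n) (p l s - q l s))) => //.
  - apply: (@continuous_sum_ord R n (fun l s => x l * (D l s * p l (t - s)))) => i _.
    apply: continuous_mull; apply: continuous_mul => //.
    by apply: continuous_reflect; exact: (flow_continuous pF).
  - move=> s /andP[s0 st].
    have ts0 : 0 < t - s by rewrite subr_gt0.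
    set U := flux x n p (t - s).
    pose dh l := x l * (D l s * - (U - x l * p l (t - s)) +
                        p l (t - s) * (p l s - q l s)).
    have <- : \sum_(l < n) dh l = U * \sum_(l < n) (p l s - q l s).
      transitivity (\sum_(l < n) (G s * (x l * p l (t - s)) - U * (x l * D l s))).
        by apply: eq_bigr => i _; rewrite (GE i) /dh; ring.
      rewrite sumrB -mulr_sumr sum_flux// -/U -mulr_sumr.
      transitivity (U * (\sum_(l < n) G s - \sum_(l < n) x l * D l s)).
        by rewrite sumr_const card_ord -[G s *+ n]mulr_natl; ring.
      by rewrite -sumrB; congr (_ * _); apply: eq_bigr => i _; rewrite (GE i); ring.
    apply: (@is_derive_sum_ord R n (fun l s => x l * (D l s * p l (t - s)))).
    move=> i lin; apply: is_derive_mull; apply: is_derive_mul; first exact: dD.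
    exact: is_derive_reflect (flow_derive pF lin ts0).
  - by move=> s /andP[s0 _]; rewrite mulr_ge0// missing_mass// ltW.
have h0 : h 0 = 0 by apply: big1 => i _; rewrite D0// mul0r mulr0.
have ht : h t = n%:R^-1 * \sum_(i < n) x i * D i t.
  rewrite mulr_sumr; apply: eq_bigr => i _.
  by rewrite subrr (flow_init pF)// mulrA mulrC.
by move: hle; rewrite h0 ht pmulr_rge0// invr_gt0 ltr0n.
Qed.

(** Averaging [GE] over the first [n] traps writes [n * G] as a sum of two nonnegative
    terms. *)
Lemma renewal_le t : 0 <= t -> renewal m q t <= renewal n p t.
Proof.
move=> t0; rewrite -subr_ge0 -/(G t).
have : 0 <= n%:R * G t.
  rewrite mulr_natl -[n in X in 0 <= X]card_ord -sumr_const.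
  under eq_bigr => i _ do rewrite (GE i).
  by rewrite big_split addr_ge0// ?missing_mass// weighted_gap_ge0.
by rewrite pmulr_rge0// ltr0n.
Qed.

(** By [GE] the gap satisfies [D i' + x i * D i = G >= 0]. *)
Lemma occupation_le i t : (i < n)%N -> 0 <= t ->
  occupation m q i t <= occupation n p i t.
Proof.
move=> lin t0; rewrite -subr_ge0 -/(D i t) -[leLHS](mul0r (expR (- (x i * t)))).
rewrite -(D0 lin).
apply: (ge0_derive_decay_le t0 (@Dc i) (df := fun s => p i s - q i s)).
  by move=> s /andP[s0 _]; exact: dD.
by move=> s /andP[s0 _]; rewrite -GE subr_ge0 renewal_le// ltW.
Qed.

End two_flows.
End trap_flow.

(** * Marginals and holding times of finite Markov chains *)

Section transition.
Context {R : realType}.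
Implicit Types (s t h : R).

Lemma is_derive_one_sided (f : R -> R) t (d : R) :
  (f (t + h) - f t) / h @[h --> 0^'+] --> d ->
  (f t - f (t - h)) / h @[h --> 0^'+] --> d -> is_derive t 1 f d.
Proof.
move=> fr fl.
have h : h^-1 * (f (h * 1 + t) - f t) @[h --> (0 : R)^'] --> d.
  apply: (@cvg_at_right_left_dnbhs _ R^o).
    apply: cvg_trans fr; apply: near_eq_cvg; near=> h.
    by rewrite /= mulr1 [h + t]addrC [RHS]mulrC.
  apply/cvg_at_leftNP; rewrite oppr0.
  apply: cvg_trans fl; apply: near_eq_cvg; near=> h.
  rewrite /= mulr1 [- h + t]addrC invrN.
  by rewrite -mulrN1 -[in RHS]mulrN1; ring.
apply: DeriveDef; first by apply/cvg_ex; exists d.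
exact: cvg_lim h.
Unshelve. all: by end_near. Qed.

Context {S : finType} (q : S -> S -> R) (p : R -> S -> S -> R).
Hypothesis tf : is_transition_function q p.

Definition generator k l : R := if k == l then - \sum_(j | j != k) q k j else q k l.

Lemma transition_generator k l :
  (p h k l - (k == l)%:R) / h @[h --> 0^'+] --> generator k l.
Proof.
have [p0 p1 pinit psemi prate] := tf; rewrite /generator.
have [<-|kl] := eqVneq k l; last first.
  by under eq_fun do rewrite subr0; exact: prate.
rewrite -sumrN.
have h : \sum_(j | j != k) - (p h k j / h) @[h --> 0^'+] --> \sum_(j | j != k) - q k j.
  apply: cvg_big => [|j jk]; first exact: add_continuous.
  by apply: cvgN; apply: prate; rewrite eq_sym.
apply: cvg_trans h; apply: near_eq_cvg; near=> h.
have h0 : 0 < h by [].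
have -> : true%:R = p h k k + \sum_(j | j != k) p h k j.
  by rewrite -(p1 h k (ltW h0)) (bigD1 k).
rewrite opprD addrA subrr add0r sumrN mulNr -mulr_suml.
Unshelve. all: by end_near. Qed.

Lemma transition_near0 k l : p h k l - (k == l)%:R @[h --> 0^'+] --> (0 : R).
Proof.
have h : h * ((p h k l - (k == l)%:R) / h) @[h --> 0^'+] --> 0 * generator k l.
  apply: cvgM; last exact: transition_generator.
  exact: cvg_at_right_filter.
rewrite mul0r in h; apply: cvg_trans h; apply: near_eq_cvg; near=> h.
have h0 : 0 < h by [].
by rewrite mulrC divfK// gt_eqF.
Unshelve. all: by end_near. Qed.

Context (mu : S -> R) (mu_ge0 : forall k, 0 <= mu k) (mu_sum : \sum_k mu k = 1).

(** Negative times are clipped to [0] to get a function continuous on the whole line. *)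
Definition marginal l t : R := \sum_k mu k * p (Num.max t 0) k l.

Lemma marginal_ge0 l t : 0 <= marginal l t.
Proof.
have [p0 _ _ _ _] := tf; apply: sumr_ge0 => k _.
by rewrite mulr_ge0 ?p0// le_max lexx orbT.
Qed.

Lemma marginal_sum t : \sum_l marginal l t = 1.
Proof.
have [_ p1 _ _ _] := tf; rewrite exchange_big/= -mu_sum; apply: eq_bigr => k _.
by rewrite -mulr_sumr p1 ?mulr1// le_max lexx orbT.
Qed.

Lemma marginal_le1 l t : marginal l t <= 1.
Proof.
rewrite -(marginal_sum t) (bigD1 l)//= lerDl.
by apply: sumr_ge0 => k _; exact: marginal_ge0.
Qed.

Lemma marginalD l s h : 0 <= s -> 0 <= h ->
  marginal l (s + h) = \sum_k marginal k s * p h k l.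
Proof.
move=> s0 h0; have [_ _ _ pD _] := tf.
rewrite /marginal; under [RHS]eq_bigr => k _ do rewrite mulr_suml.
rewrite exchange_big/=; apply: eq_bigr => k _.
rewrite !max_l ?addr_ge0// pD// mulr_sumr.
by apply: eq_bigr => j _; rewrite mulrA.
Qed.

Lemma marginal_increment l s h : 0 <= s -> 0 <= h ->
  marginal l (s + h) - marginal l s =
  \sum_k marginal k s * (p h k l - (k == l)%:R).
Proof.
move=> s0 h0; rewrite marginalD//; under [RHS]eq_bigr => k _ do rewrite mulrBr.
rewrite sumrB; congr (_ - _); rewrite (bigD1 l)//= eqxx mulr1 big1 ?addr0// => k kl.
by rewrite (negbTE kl) mulr0.
Qed.

(** The increment between times [s] and [s + h] is bounded by a quantity that depends on [h]
    only and tends to [0]; this gives continuity from both sides. *)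
Lemma continuous_marginal l : continuous (marginal l).
Proof.
move=> t; apply/cvgrPdist_lt => e e0.
have h0 : \sum_k `|p h k l - (k == l)%:R| @[h --> 0^'+] --> \sum_(k : S) `|0 : R|.
  apply: cvg_big => [|k _]; first exact: add_continuous.
  by apply: cvg_norm; exact: transition_near0.
rewrite big1 in h0; last by move=> k _; rewrite normr0.
have /cvgrPdist_lt/(_ e e0)[r /= r0 hr] := h0.
have modulus a b : 0 <= a -> a <= b -> b - a < r -> `|marginal l b - marginal l a| < e.
  move=> a0; rewrite le_eqVlt => /predU1P[<-|ab] br; first by rewrite subrr normr0.
  have ba : 0 < b - a by rewrite subr_gt0.
  rewrite -[X in marginal l X - _](subrKC a) marginal_increment ?(ltW ba)//.
  have /= := hr (b - a); rewrite /ball_ !sub0r !normrN => /(_ _ ba).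
  rewrite gtr0_norm// => /(_ br); apply: le_lt_trans.
  rewrite [leRHS]ger0_norm ?sumr_ge0//.
  apply: le_trans (ler_norm_sum _ _ _) _; apply: ler_sum => k _.
  rewrite normrM ler_piMl// ger0_norm ?marginal_ge0//; exact: marginal_le1.
near=> s.
have clip u : marginal l u = marginal l (Num.max u 0).
  by rewrite /marginal -maxA maxxx.
rewrite (clip t) (clip s).
have st : `|Num.max t 0 - Num.max s 0| < r.
  apply: (@le_lt_trans _ _ `|t - s|); last by near: s; exact: cvgr_dist_lt.
  rewrite ler_norml; have := ler_norm (t - s); have := ler_norm (s - t).
  by rewrite distrC => h1 h2; case: (leP t 0); case: (leP s 0) => *; apply/andP; split; lra.
have [ts|/ltW ts] := leP (Num.max t 0) (Num.max s 0).
  rewrite distrC modulus// ?le_max ?lexx ?orbT//.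
  by move: st; rewrite distrC ger0_norm// subr_ge0.
by rewrite modulus// ?le_max ?lexx ?orbT//; move: st; rewrite ger0_norm// subr_ge0.
Unshelve. all: by end_near. Qed.

(** Kolmogorov's forward equation.  The transition rates only give derivatives from the
    right at time [0]; the left derivative at [t] also uses the continuity of the
    marginals at [t]. *)
Lemma is_derive_marginal l t : 0 < t ->
  is_derive t 1 (marginal l) (\sum_k marginal k t * generator k l).
Proof.
move=> t0; apply: is_derive_one_sided.
  have h : \sum_k marginal k t * ((p h k l - (k == l)%:R) / h) @[h --> 0^'+] -->
     \sum_k marginal k t * generator k l.
    apply: cvg_big => [|k _]; first exact: add_continuous.
    by apply: cvgM; [exact: cvg_cst|exact: transition_generator].
  apply: cvg_trans h; apply: near_eq_cvg; near=> h.
  have h0 : 0 < h by [].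
  rewrite marginal_increment ?ltW// mulr_suml.
  by apply: eq_bigr => k _; rewrite mulrA.
have h : \sum_k marginal k (t - h) * ((p h k l - (k == l)%:R) / h) @[h --> 0^'+] -->
     \sum_k marginal k t * generator k l.
  apply: cvg_big => [|k _]; first exact: add_continuous.
  apply: cvgM; last exact: transition_generator.
  have c : continuous (fun h => marginal k (t - h)).
    by apply: continuous_reflect; exact: continuous_marginal.
  by have := cvg_at_right_filter (c 0); rewrite subr0.
apply: cvg_trans h; apply: near_eq_cvg; near=> h.
have h0 : 0 < h by [].
have ht : h < t by near: h; exact: nbhs_right_lt.
rewrite -[X in marginal l X - _](subrK h t) marginal_increment ?subr_ge0 ?ltW//.
by rewrite mulr_suml; apply: eq_bigr => k _; rewrite mulrA.
Unshelve. all: by end_near. Qed.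

End transition.

Section chain.
Context {d : measure_display} {T : measurableType d} {R : realType}.
Context (P : probability T R).

Lemma measure_finite_partition {S : finType} (Z : T -> S) (A : set T) :
  measurable A -> (forall k, measurable (Z @^-1` [set k])) ->
  P A = (\sum_k P (A `&` Z @^-1` [set k]))%E.
Proof.
move=> mA mZ.
have {1}-> : A = \bigcup_(k in [set: S]) (A `&` Z @^-1` [set k]).
  by apply/seteqP; split => [w Aw|w [k _ []]//]; exists (Z w).
rewrite measure_fin_bigcup; last 3 first.
- exact: finite_finset.
- by move=> i j _ _ [w [[_ /= <-] [_ /= <-]]].
- by move=> i _; exact: measurableI.
rewrite (fsbigE (index_enum S)) ?index_enum_uniq//; last first.
  by move=> i _; rewrite mem_index_enum.
by apply: eq_bigl => i; rewrite in_setT.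
Qed.

Context {S : finType} (mu : S -> R) (q : S -> S -> R) (Y : R -> T -> S).
Context (p : R -> S -> S -> R).
Hypothesis mY : forall t i, 0 <= t -> measurable (Y t @^-1` [set i]).
Hypothesis rcY : forall w t, 0 <= t -> \forall s \near t^'+, Y s w = Y t w.
Hypothesis tf : is_transition_function q p.
Hypothesis fdd : forall (n : nat) (t : nat -> R) (s : nat -> S),
  t 0%N = 0 -> nondecreasing_seq t ->
  P [set w | forall k, (k <= n)%N -> Y (t k) w = s k] =
  (mu (s 0%N) * \prod_(k < n) p (t k.+1 - t k) (s k) (s k.+1))%:E.

Lemma stay_grid (l : S) (tw h : R) (N : nat) : 0 <= tw -> 0 <= h ->
  P [set w | forall i, (i <= N)%N -> Y (tw + i%:R * h) w = l] =
  (marginal p mu l tw * p h l l ^+ N)%:E.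
Proof.
move=> tw0 h0; set B := [set w | _].
have gr0 i : 0 <= tw + i%:R * h by rewrite addr_ge0// mulr_ge0.
have mB : measurable B.
  have -> : B = \bigcap_(i in [set i | (i <= N)%N]) (Y (tw + i%:R * h) @^-1` [set l]).
    by apply/seteqP; split.
  by apply: bigcap_measurableType => i _; exact: mY.
rewrite (@measure_finite_partition _ (Y 0) _ mB); last by move=> k; exact: mY.
pose t k := if k is k'.+1 then tw + k'%:R * h else 0.
have tn : nondecreasing_seq t.
  apply/nondecreasing_seqP => -[|k] /=; first by rewrite mul0r addr0.
  by rewrite lerD2l ler_wpM2r// ler_nat.
rewrite /marginal max_l//.
rewrite mulr_suml -sumEFin; apply: eq_bigr => k _.
pose s j := if j is 0 then k else l.
have := fdd N.+1 s (erefl : t 0 = 0) tn.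
have -> : [set w | forall j, (j <= N.+1)%N -> Y (t j) w = s j] =
    B `&` Y 0 @^-1` [set k].
  apply/seteqP; split => w /=.
    by move=> H; split => [i iN|]; [exact: (H i.+1)|exact: (H 0)].
  by move=> [HB H0] [|i]//= iN; exact: HB.
move=> ->; congr _%:E; rewrite big_ord_recl/= mul0r addr0 subr0 -mulrA.
congr (_ * (_ * _)).
under eq_bigr => i _ do rewrite /bump/=.
rewrite (eq_bigr (fun=> p h l l)); first by rewrite prodr_const card_ord.
by move=> i _; congr (p _ _ _); rewrite -natr1; ring.
Qed.

Lemma marginalE (l : S) (t : R) : 0 <= t -> P (Y t @^-1` [set l]) = (marginal p mu l t)%:E.
Proof.
move=> t0.
have := stay_grid l 0 t0 (lexx 0); rewrite expr0 mulr1 => <-; congr (P _).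
apply/seteqP; split => w /=; first by move=> H [|//] _; rewrite mul0r addr0.
by move=> /(_ 0%N); rewrite mul0r addr0; apply.
Qed.

(** Between two points of a fine enough grid, right-continuity leaves no room for an
    excursion away from [l]. *)
Lemma stay_dyadic (l : S) (w : T) (tw t : R) : 0 <= tw -> 0 < t ->
  (forall k i, (i <= 2 ^ k)%N -> Y (tw + i%:R * (t / (2 ^ k)%:R)) w = l) ->
  forall s, tw <= s <= tw + t -> Y s w = l.
Proof.
move=> tw0 t0 H s /andP[tws]; rewrite le_eqVlt => /predU1P[->|st].
  have := H 0%N 1%N isT; by rewrite expn0 divr1 mul1r.
have s0 : 0 <= s by exact: le_trans tws.
have [r /= r0 hr] := rcY w s0.
have [k _ /(_ k (leqnn _)) hk] := cvgr_lt _ (cvg_dyadic_step t) _ r0.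
have p0 : 0 < (2 ^ k)%:R :> R by rewrite ltr0n expn_gt0.
set h := t / (2 ^ k)%:R in hk.
have h0 : 0 < h by rewrite divr_gt0.
pose i := Num.truncn ((s - tw) / h).
have sh0 : 0 <= (s - tw) / h by rewrite divr_ge0 ?subr_ge0// ltW.
have := truncn_itv sh0; rewrite -/i ler_pdivlMr// ltr_pdivrMr// => /andP[i1 i2].
have iN : (i.+1 <= 2 ^ k)%N.
  rewrite -(ltr_nat R) -(ltr_pM2r h0); apply: le_lt_trans i1 _.
  by rewrite /h mulrC divfK ?gt_eqF// ltrBlDl.
rewrite -(H k i.+1 iN) -/h; apply/esym; apply: hr.
  rewrite /ball_/= opprD addrA ltr_norml.
  by move: i1 i2; rewrite -natr1 mulrDl mul1r => ? ?; apply/andP; split; lra.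
by rewrite -ltrBlDl.
Qed.

(** The events of standing in [l] at the points of the dyadic grids decrease to the event of
    standing in [l] throughout, and their probabilities are powers of [p h l l]. *)
Lemma no_jump_probE (r : S -> R) (tw t : R) : 0 <= tw -> 0 < t ->
  (forall l, generator q l l = - r l) ->
  no_jump_prob P Y t tw = \sum_l marginal p mu l tw * expR (- (r l * t)).
Proof.
move=> tw0 t0 rE; rewrite /no_jump_prob.
set A := [set w | _].
pose B l k := [set w | forall i, (i <= 2 ^ k)%N -> Y (tw + i%:R * (t / (2 ^ k)%:R)) w = l].
have g0 (i k : nat) : 0 <= i%:R * (t / (2 ^ k)%:R) by rewrite mulr_ge0// divr_ge0// ltW.
have mB l k : measurable (B l k).
  have -> : B l k = \bigcap_(i in [set i | (i <= 2 ^ k)%N])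
      (Y (tw + i%:R * (t / (2 ^ k)%:R)) @^-1` [set l]).
    by apply/seteqP; split.
  by apply: bigcap_measurableType => i _; apply: mY; rewrite addr_ge0.
have BE l : \bigcap_k B l k = A `&` Y tw @^-1` [set l].
  apply/seteqP; split => w.
    move=> H.
    have Hs : forall s, tw <= s <= tw + t -> Y s w = l.
      by apply: stay_dyadic => // k; exact: H.
    have Htw : Y tw w = l by apply: Hs; rewrite lexx lerDl ltW.
    by split => //= s /Hs; rewrite Htw.
  move=> [/= Aw Yl] k _ i iN; rewrite Aw//.
  rewrite lerDl g0/= lerD2l mulrCA ler_piMr ?(ltW t0)//.
  by rewrite ler_pdivrMr ?mul1r ?ler_nat// ltr0n expn_gt0.
have PB l : P (A `&` Y tw @^-1` [set l]) = (marginal p mu l tw * expR (- (r l * t)))%:E.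
  rewrite -BE.
  have h1 : P (B l k) @[k --> \oo] --> P (\bigcap_k B l k).
    apply: nonincreasing_cvg_mu => //.
    - by rewrite (le_lt_trans (probability_le1 _ _))// ltry.
    - exact: bigcap_measurableType.
    - apply/nonincreasing_seqP => k; apply/subsetPset => w H i iN.
      have := H (2 * i)%N; rewrite expnS leq_mul2l iN orbT => /(_ isT) <-.
      by congr (Y (_ + _) w); rewrite !natrM; field; rewrite gt_eqF// ltr0n expn_gt0.
  have h2 : P (B l k) @[k --> \oo] --> (marginal p mu l tw * expR (- (r l * t)))%:E.
    under eq_fun => k.
      rewrite /B stay_grid//; last by rewrite divr_ge0// ltW.
      over.
    apply: cvg_EFin; first by apply: nearW.
    apply: cvgMl_tmp; apply: (@cvg_pow_dyadic R (fun h => p h l l)) => //.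
      have h3 : p h l l - (l == l)%:R + (l == l)%:R @[h --> 0^'+] --> (0 + (l == l)%:R : R).
        by apply: cvgD; [exact: (transition_near0 tf)|exact: cvg_cst].
      by move: h3; under eq_fun do rewrite subrK; rewrite add0r eqxx.
    by have := @transition_generator R S q p tf l l; rewrite eqxx rE.
  exact: cvg_unique h1 h2.
have mA : measurable A.
  have -> : A = \bigcup_(l in [set: S]) \bigcap_k B l k.
    apply/seteqP; split => [w Aw|w [l _]]; last by rewrite BE => -[].
    by exists (Y tw w) => //; rewrite BE.
  apply: fin_bigcup_measurable; first exact: finite_finset.
  by move=> l _; exact: bigcap_measurableType.
rewrite (@measure_finite_partition _ (Y tw) _ mA); last by move=> k; exact: mY.
by under eq_bigr => l _ do rewrite PB; rewrite sumEFin.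
Qed.

End chain.

Section trap_chain.
Context {d : measure_display} {T : measurableType d} {R : realType}.

(** The forward equation of the trap chain is the system of [trap_flow], and its holding
    time in [i] is exponential with rate [x i * (1 - 1 / n)], as one of the [n] equally
    likely targets is [i] itself. *)
Lemma trap_chain_flow (P : probability T R) (x : nat -> R) (n : nat)
    (Y : R -> T -> 'I_n.-1.+1) : (0 < n)%N ->
  is_markov_chain P (fun=> #|{: 'I_n.-1.+1}|%:R^-1)
    (fun i _ : 'I_n.-1.+1 => x i / n%:R) Y ->
  exists p, [/\ trap_flow x n p,
    forall (i : 'I_n.-1.+1) (t : R), 0 <= t -> P (Y t @^-1` [set i]) = (p i t)%:E
  & forall tw t : R, 0 <= tw -> 0 < t -> no_jump_prob P Y t tw =
      \sum_(i < n) p i tw * expR (- (x i * (1 - n%:R^-1) * t))].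
Proof.
case: n Y => // m Y _ [mY rcY [p tf fdd]].
pose mu (_ : 'I_m.+1) : R := #|{: 'I_m.+1}|%:R^-1.
pose q (i _ : 'I_m.+1) : R := x i / m.+1%:R.
have muE k : mu k = m.+1%:R^-1 by rewrite /mu card_ord.
have mu0 k : 0 <= mu k by rewrite muE invr_ge0.
have mu1 : \sum_k mu k = 1.
  under eq_bigr do rewrite muE.
  by rewrite sumr_const card_ord -[LHS]mulr_natl divff// pnatr_eq0.
have gE l : generator q l l = - (x l * (1 - m.+1%:R^-1)).
  rewrite /generator eqxx sumr_const cardC1 card_ord -[X in - X]mulr_natl /q.
  by congr (- _); rewrite -natr1; field; rewrite natr1.
pose f (i : nat) (t : R) := if (i < m.+1)%N then marginal p mu (inord i) t else 0.
have fE (i : 'I_m.+1) t : f i t = marginal p mu i t by rewrite /f ltn_ord inord_val.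
exists f; split.
- split => [i|i t im t0|i im|i t|t t0|i t].
  + rewrite /f; case: (i < m.+1)%N; last by move=> t; exact: cvg_cst.
    exact: (continuous_marginal tf mu0 mu1).
  + have := is_derive_marginal tf mu0 mu1 (inord i : 'I_m.+1) t0.
    apply: is_derive_ext => [s|]; first by rewrite /f im.
    set l : 'I_m.+1 := inord i; have li : l = i :> nat by rewrite /l inordK.
    have -> : flux x m.+1 f t = m.+1%:R^-1 * \sum_(k < m.+1) x k * marginal p mu k t.
      by congr (_ * _); apply: eq_bigr => k _; rewrite fE.
    rewrite -li fE (bigD1 l)//= gE [in RHS](bigD1 l)//= [in RHS]mulrDr.
    rewrite [X in _ = _ + X - _]mulr_sumr.
    rewrite [RHS]addrAC; congr (_ + _); first by ring.
    by apply: eq_bigr => k kl; rewrite /generator (negbTE kl) /q; ring.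
  + rewrite /f im /marginal maxxx -(muE (inord i)) (bigD1 (inord i))//= big1 => [|k ki].
      by have [_ _ -> _ _] := tf; rewrite eqxx mulr1 addr0.
    by have [_ _ -> _ _] := tf; rewrite (negbTE ki) mulr0.
  + by rewrite /f; case: ifP => // _; exact: (marginal_ge0 tf mu0).
  + by under eq_bigr do rewrite fE; exact: (marginal_sum tf mu1).
  + by move=> im; rewrite /f ltnNge im.
- by move=> i t t0; rewrite fE; exact: (@marginalE _ _ _ P _ mu Y p mY fdd).
- move=> tw t tw0 t0.
  rewrite (@no_jump_probE _ _ _ P _ mu q Y p mY rcY tf fdd _ _ _ tw0 t0 gE).
  by apply: eq_bigr => i _; rewrite fE.
Qed.

End trap_chain.

(** * Infinitely many traps *)

Section trap_limit.
Context {R : realType} (x : nat -> R) (N : R -> nat) (p : R -> nat -> R -> R).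
Let tau i := (x i)^-1.
Hypothesis x_gt0 : forall i, 0 < x i.
Hypothesis x_mono : nondecreasing_seq x.
Hypothesis tau_sum : cvgn (series tau).
Hypothesis N_mono : forall a b, a <= b -> (N b <= N a)%N.
Hypothesis N_infty : forall K, exists L0, forall L, L <= L0 -> (K < N L)%N.
Hypothesis pF : forall L, (0 < N L)%N -> trap_flow x (N L) (p L).
Implicit Types (i K : nat) (t tw L : R).

Let N_near K : \forall L \near -oo, (K < N L)%N.
Proof.
have [L0 h] := N_infty K; near=> L; apply: h.
by near: L; apply: nbhs_ninfty_le; exact: num_real.
Unshelve. all: by end_near. Qed.

Let N_inv_cvg0 : (N L)%:R^-1 @[L --> -oo] --> (0 : R).
Proof.
apply/cvgrPdist_le => e e0; near=> L.
have NL : (Num.truncn e^-1 < N L)%N by near: L; exact: N_near.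
rewrite sub0r normrN ger0_norm ?invr_ge0// -[leRHS]invrK.
rewrite lef_pV2 ?posrE ?ltr0n ?invr_gt0//; last exact: leq_ltn_trans NL.
have /truncn_itv/andP[_ /ltW h] : 0 <= e^-1 by rewrite invr_ge0 ltW.
by apply: le_trans h _; rewrite ler_nat.
Unshelve. all: by end_near. Qed.

(** [p L i] is a combination of two quantities which are monotone in the number of traps. *)
Lemma flow_is_cvg i t : 0 <= t -> cvg (p L i t @[L --> -oo]).
Proof.
move=> t0; have [L0 h] := N_infty i.
have N0 L : L <= L0 -> (0 < N L)%N by move=> /h; exact: leq_ltn_trans.
have cV : cvg (renewal x (N L) (p L) t @[L --> -oo]).
  apply: (@nondecreasing_is_cvgNy R _ L0) => [a b ab bL|a aL].
    apply: renewal_le => //; [exact: N0|exact: N_mono|exact/pF/N0|].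
    exact/pF/N0/(le_trans ab).
  by apply: (renewal_ge0 x_gt0 (N0 _ aL) (pF (N0 _ aL))).
have cW : cvg (occupation x (N L) (p L) i t @[L --> -oo]).
  apply: (@nondecreasing_is_cvgNy R _ L0) => [a b ab bL|a aL].
    apply: occupation_le => //; [exact: N0|exact: N_mono|exact/pF/N0| |exact: h].
    exact/pF/N0/(le_trans ab).
  by apply: (occupation_ge0 x_gt0 (N0 _ aL) (pF (N0 _ aL)) (h _ aL)).
have -> : (fun L => p L i t) = (fun L => renewal x (N L) (p L) t -
    x i * occupation x (N L) (p L) i t).
  by apply/funext => L; rewrite (renewal_occupation x_gt0 (N L) (p L) i); ring.
by apply: is_cvgB => //; apply: is_cvgM => //; exact: is_cvg_cst.
Qed.

Definition limit_law i t : R := lim (p L i t @[L --> -oo]).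

Lemma cvg_limit_law i t : 0 <= t -> p L i t @[L --> -oo] --> limit_law i t.
Proof. exact: flow_is_cvg. Qed.

Lemma limit_law_ge0 i t : 0 <= t -> 0 <= limit_law i t.
Proof.
move=> t0; have h : p L i t @[L --> -oo] --> limit_law i t by exact: cvg_limit_law.
apply: (cvgr_to_ge h).
by near=> L; apply: (flow_ge0 (pF _)); near: L; exact: N_near.
Unshelve. all: by end_near. Qed.

Lemma flow_partial_le1 L K t : (0 < N L)%N -> 0 <= t ->
  \sum_(i < K) p L i t <= 1.
Proof.
move=> N0 t0; have F := pF N0; rewrite -(flow_sum F t0).
rewrite -!(big_mkord xpredT (fun i => p L i t)).
have [KN|/ltnW NK] := leqP K (N L).
  rewrite [leRHS](big_cat_nat (leq0n K) KN)//= lerDl.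
  by apply: sumr_ge0 => i _; exact: (flow_ge0 F).
rewrite (big_cat_nat (leq0n (N L)) NK)//= -[leRHS]addr0 lerD2l.
by rewrite big_nat_cond big1// => i /andP[/andP[Ni _] _]; exact: (flow_out F).
Qed.

Lemma limit_law_partial_le1 K t : 0 <= t -> \sum_(i < K) limit_law i t <= 1.
Proof.
move=> t0; have h : \sum_(i < K) p L i t @[L --> -oo] --> \sum_(i < K) limit_law i t.
  by apply: cvg_big => [|i _]; [exact: add_continuous|exact: cvg_limit_law].
apply: (cvgr_to_le h); near=> L; apply: flow_partial_le1 => //.
by near: L; exact: N_near.
Unshelve. all: by end_near. Qed.

Lemma tau_cvg0 : tau i @[i --> \oo] --> 0.
Proof. exact: cvg_series_cvg_0. Qed.

Lemma partition_sumE n : partition_sum x n = series tau n.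
Proof. by rewrite /partition_sum -(big_mkord xpredT tau). Qed.

Lemma tau_total_gt0 : 0 < limn (series tau).
Proof.
apply: (@lt_le_trans _ _ (series tau 1)).
  by rewrite -partition_sumE partition_sum_gt0.
apply: nondecreasing_cvgn_le => //; apply/nondecreasing_seqP => n.
by rewrite -!partition_sumE /partition_sum big_ord_recr/= lerDl invr_ge0 ltW.
Qed.

Lemma limit_law_equilibrium i t : 0 <= t ->
  `|limit_law i t - tau i / limn (series tau)| <= expR (- (x 0%N * t)).
Proof.
move=> t0; have Ninf : N L @[L --> -oo] --> \oo.
  by apply/cvgnyPgt => K; exact: N_near.
have h : `|p L i t - tau i / series tau (N L)| @[L --> -oo] -->
   `|limit_law i t - tau i / limn (series tau)|.
  apply: cvg_norm; apply: cvgB; first exact: cvg_limit_law.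
  apply: cvgMl_tmp; apply: cvgV; first by rewrite gt_eqF// tau_total_gt0.
  exact: (@cvg_comp _ _ _ N (series tau) _ _ _ Ninf tau_sum).
apply: (cvgr_to_le h); near=> L; rewrite -partition_sumE.
have iN : (i < N L)%N by near: L; exact: N_near.
have N0 : (0 < N L)%N by exact: leq_ltn_trans iN.
by apply: (flow_equilibrium x_gt0 N0 (pF N0)) => // k; exact: x_mono.
Unshelve. all: by end_near. Qed.

(** The rates tend to infinity because their inverses are summable. *)
Lemma x_decay_cvg0 t : 0 < t -> expR (- (x K * t)) @[K --> \oo] --> (0 : R).
Proof.
move=> t0.
have h : tau K / t @[K --> \oo] --> (0 : R).
  by rewrite -[X in _ --> X](mul0r t^-1); apply: cvgMr_tmp; exact: tau_cvg0.
apply: squeeze_cvgr (cvg_cst 0) h; near=> K.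
have xt : 0 < x K * t by rewrite mulr_gt0.
rewrite expR_ge0/= expRN /tau -invfM lef_pV2 ?posrE ?expR_gt0//.
by apply: le_trans (expR_ge1Dx _); rewrite lerDr.
Unshelve. all: by end_near. Qed.

Lemma limit_law_cvg i : limit_law i t @[t --> +oo] --> tau i / limn (series tau).
Proof.
apply/cvgrPdist_le => e e0.
have /cvgrPdist_le/(_ e e0) h := cvg_expR_decay (x_gt0 0%N).
near=> tw.
have tw0 : 0 <= tw by near: tw; apply: nbhs_pinfty_ge; exact: num_real.
rewrite distrC; apply: le_trans (limit_law_equilibrium i tw0) _.
have : `|0 - expR (- (x 0%N * tw))| <= e by near: tw; exact: h.
by rewrite sub0r normrN ger0_norm ?expR_ge0.
Unshelve. all: by end_near. Qed.

Let partial t tw K := \sum_(i < K) limit_law i tw * expR (- (x i * t)).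

Definition limit_no_jump t tw : R := limn (partial t tw).

Lemma decay_tail t i K : 0 < t -> (K <= i)%N ->
  0 <= expR (- (x i * t)) <= expR (- (x K * t)).
Proof.
by move=> t0 Ki; rewrite expR_ge0 ler_expR lerN2 ler_pM2r// x_mono.
Qed.

(** With at least two traps the exit rates are at least [x i / 2], whence the truncation
    error. *)
Lemma cvg_no_jump t tw : 0 < t -> 0 <= tw ->
  cvgn (partial t tw) /\
  \sum_(i < N L) p L i tw * expR (- (x i * (1 - (N L)%:R^-1) * t)) @[L --> -oo]
    --> limit_no_jump t tw.
Proof.
move=> t0 tw0.
pose c L i := expR (- (x i * (1 - (N L)%:R^-1) * t)).
pose S L K := \sum_(i < K) p L i tw * c L i.
apply: (@cvg_truncation R _ _ _ _ S _ (fun K => expR (- (x K * (t / 2))))).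
- move=> K; near=> L.
  have KN : (K < N L)%N by near: L; exact: N_near.
  have N1 : (1 < N L)%N by near: L; exact: N_near.
  have N0 : (0 < N L)%N by exact: ltnW.
  apply: (@weighted_tail R (fun i => p L i tw) (c L)) => //; last exact: ltnW.
  + by move=> i; exact: (flow_ge0 (pF N0)).
  + by move=> k; exact: flow_partial_le1.
  + move=> i Ki; rewrite expR_ge0/= ler_expR lerN2 -mulrA ler_pM ?x_mono ?(ltW (x_gt0 _))//.
      by rewrite divr_ge0// ltW.
    rewrite mulrC ler_pM2r//.
    have : (N L)%:R^-1 <= 2^-1 :> R by rewrite lef_pV2 ?posrE ?ltr0n// ler_nat.
    by lra.
- move=> K; apply: cvg_big => [|i _]; first exact: add_continuous.
  apply: cvgM; first exact: cvg_limit_law.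
  apply: (@cvg_comp _ _ _ (fun L => - (x i * (1 - (N L)%:R^-1) * t)) expR _
    (nbhs (- (x i * t)))).
    apply: cvgN; apply: cvgMr_tmp.
    rewrite -[X in _ --> X]mulr1; apply: cvgMl_tmp.
    rewrite -[X in _ --> X]subr0; apply: cvgB; first exact: cvg_cst.
    exact: N_inv_cvg0.
  exact: continuous_expR.
- by apply: x_decay_cvg0; rewrite divr_gt0.
Unshelve. all: by end_near. Qed.

Lemma limit_no_jump_equilibrium t : 0 < t ->
  limit_no_jump t tw @[tw --> +oo] -->
  limn (series (fun i => tau i * expR (- x i * t))) / limn (series tau).
Proof.
move=> t0; set Z := limn (series tau).
pose sigma K := \sum_(i < K) tau i / Z * expR (- (x i * t)).
have [sc h] : cvgn sigma /\ limit_no_jump t tw @[tw --> +oo] --> limn sigma.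
  apply: (@cvg_truncation R _ _ _ _ (fun tw K => partial t tw K) _
    (fun K => expR (- (x K * t)))).
  - move=> K; near=> tw.
    have tw0 : 0 <= tw by near: tw; apply: nbhs_pinfty_ge; exact: num_real.
    have [cp _] := cvg_no_jump t0 tw0.
    have h : `|partial t tw M - partial t tw K| @[M --> \oo] -->
        `|limit_no_jump t tw - partial t tw K|.
      by apply: cvg_norm; apply: cvgB => //; exact: cvg_cst.
    apply: (cvgr_to_le h); near=> M.
    apply: (@weighted_tail R (fun i => limit_law i tw) (fun i => expR (- (x i * t)))) => //.
    + by move=> i; exact: limit_law_ge0.
    + by move=> k; exact: limit_law_partial_le1.
    + by move=> i; exact: decay_tail.
    + by near: M; exact: nbhs_infty_ge.
  - move=> K; apply: cvg_big => [|i _]; first exact: add_continuous.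
    apply: cvgMr_tmp; exact: limit_law_cvg.
  - exact: x_decay_cvg0.
have -> : limn (series (fun i => tau i * expR (- x i * t))) / Z = limn sigma.
  have Z0 : Z != 0 by rewrite gt_eqF// tau_total_gt0.
  have E : series (fun i => tau i * expR (- x i * t)) = (fun K => sigma K * Z).
    apply/funext => K; rewrite /series/= big_mkord mulr_suml.
    by apply: eq_bigr => i _; rewrite mulNr; field.
  have sZ : sigma K * Z @[K --> \oo] --> limn sigma * Z by apply: cvgMr_tmp; exact: sc.
  by rewrite E (cvg_lim _ sZ)// mulfK.
exact: h.
Unshelve. all: by end_near. Qed.

(** Even the deepest trap is left before time [theta * tw] when [tw] is large. *)
Lemma limit_no_jump_aging (theta : R) : 0 < theta ->
  limit_no_jump (theta * tw) tw @[tw --> +oo] --> (0 : R).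
Proof.
move=> h0; have c0 : 0 < x 0%N * theta by rewrite mulr_gt0.
apply: squeeze_cvgr (cvg_cst 0) (cvg_expR_decay c0); near=> tw.
have tw0 : 0 < tw by near: tw; apply: nbhs_pinfty_gt; exact: num_real.
have t0 : 0 < theta * tw by rewrite mulr_gt0.
have [cp _] := cvg_no_jump t0 (ltW tw0).
apply/andP; split.
  apply: (limr_ge cp); near=> K; apply: sumr_ge0 => i _.
  by rewrite mulr_ge0 ?expR_ge0// limit_law_ge0// ltW.
apply: (limr_le cp); near=> K.
apply: (@le_trans _ _ (\sum_(i < K) limit_law i tw * expR (- (x 0%N * theta * tw)))).
  apply: ler_sum => i _; rewrite ler_wpM2l ?limit_law_ge0 ?(ltW tw0)//.
  by rewrite ler_expR lerN2 -mulrA ler_pM2r// x_mono.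
by rewrite -mulr_suml ler_piMl ?expR_ge0// limit_law_partial_le1// ltW.
Unshelve. all: by end_near. Qed.

End trap_limit.

(** * The Poisson process of energies *)

Section poisson_tail.
Context {R : realType}.

(** Markov's inequality for the Poisson law, in terms of its partial sums: the ratio
    of consecutive weights is [r / n], which is at most [r / m] from rank [m] on. *)
Lemma poisson_pmf_partial_ge (r : R) (m : nat) : 0 < r -> (0 < m)%N ->
  1 - r / m%:R <= \sum_(n < m) poisson_pmf r n.
Proof.
move=> r0 m0; have mR : 0 < m%:R :> R by rewrite ltr0n.
have c0 n : 0 <= exp_coeff r n by apply: exp_coeff_ge0; exact: ltW.
have mono : nondecreasing_seq (series (exp_coeff r)).
  by apply/nondecreasing_seqP => n; rewrite /series/= big_nat_recr//= lerDl.
have cvgs := is_cvg_series_exp_coeff r.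
have sE n : series (exp_coeff r) n <= expR r.
  exact: nondecreasing_cvgn_le.
have shift k M : (0 < k)%N -> (k <= M)%N ->
    \sum_(k <= n < M) exp_coeff r n.-1 = \sum_(k.-1 <= n < M.-1) exp_coeff r n.
  by case: k => // k _; case: M => // M _; rewrite big_add1.
have key : expR r - r / m%:R * expR r <= series (exp_coeff r) m.
  rewrite lerBlDr; apply: limr_le => //; near=> M.
  have mM : (m <= M)%N by near: M; exact: nbhs_infty_ge.
  rewrite /series/= (big_cat_nat (leq0n m) mM)//= lerD2l.
  apply: (@le_trans _ _ (\sum_(m <= n < M) r / m%:R * exp_coeff r n.-1)).
    rewrite big_nat_cond [leRHS]big_nat_cond; apply: ler_sum => n /andP[/andP[mn _] _].
    case: n mn => [|n mn]; first by rewrite leqn0 => /eqP mz; rewrite mz in m0.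
    rewrite !exp_coeffE/= factS exprS natrM invfM.
    have -> : n.+1%:R^-1 * n`!%:R^-1 * (r * r ^+ n) = r / n.+1%:R * (n`!%:R^-1 * r ^+ n).
      by ring.
    rewrite ler_wpM2r ?mulr_ge0 ?invr_ge0 ?exprn_ge0 ?(ltW r0)//.
    by rewrite ler_pM2l// lef_pV2 ?posrE ?ltr0n// ler_nat.
  rewrite -mulr_sumr ler_pM2l ?divr_gt0//.
  rewrite shift//.
  apply: le_trans (sE M.-1); rewrite /series/=.
  have mM1 : (m.-1 <= M.-1)%N by rewrite -!subn1 leq_sub2r.
  by rewrite [leRHS](big_cat_nat (leq0n m.-1) mM1)//= lerDr sumr_ge0.
have -> : \sum_(n < m) poisson_pmf r n = series (exp_coeff r) m / expR r.
  rewrite /series/= big_mkord mulr_suml; apply: eq_bigr => n _.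
  by rewrite /poisson_pmf r0 expRN exp_coeffE/= [in RHS]mulrC; ring.
rewrite ler_pdivlMr ?expR_gt0//; apply: le_trans key.
by rewrite mulrBl mul1r.
Unshelve. all: by end_near. Qed.

Lemma energy_intensity_tail (alpha a : R) : 0 < alpha ->
  energy_intensity alpha `[a, +oo[ = (expR (- alpha * a))%:E.
Proof.
move=> a0; rewrite /energy_intensity.
pose F t : R := - expR (- alpha * t).
have dF (t : R) : is_derive t 1 F (alpha * expR (- alpha * t)).
  have h : is_derive t 1 (fun s : R => - alpha * s) (- alpha * 1).
    by have := is_deriveZ (- alpha) (is_derive_id t (1 : R)).
  have := is_deriveN (@is_derive1_comp R expR _ t _ _ (is_derive_expR _) h).
  move=> k; apply: is_derive_eq k _; ring.
have Fc : continuous F.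
  by move=> t; apply/differentiable_continuous/derivable1_diffP.
rewrite (@ge0_continuous_FTC2y R _ F a 0) ?oppeK ?add0e//.
- by rewrite /F EFinN oppeK.
- by move=> t _; rewrite mulr_ge0 ?expR_ge0// ltW.
- apply: continuous_subspaceT => t; apply: cvgMl_tmp.
  have -> : (fun t => expR (- alpha * t)) = (fun t => - F t).
    by apply/funext => s; rewrite opprK.
  by rewrite -[X in _ --> X]opprK; apply: cvgN; exact: Fc.
- rewrite -oppr0; apply: cvgN; under eq_fun do rewrite mulNr.
  exact: cvg_expR_decay.
- by apply: cvg_at_right_filter; exact: Fc.
- by move=> t _; rewrite derive1E; exact: derive_val.
Qed.

End poisson_tail.

Section sparse_energies.
Context {R : realType}.

(** Cauchy condensation: between the ranks [2 ^ k] and [2 ^ k.+1] there are [2 ^ k]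
    terms, none of which exceeds the one of rank [2 ^ k]. *)
Lemma cvgn_condensation (e : nat -> R) (a : R) (K : nat) : decreasing_seq e ->
  2 * expR (- a) < 1 -> (forall k, (K <= k)%N -> e (2 ^ k)%N < - (a * k%:R)) ->
  cvgn (series (fun i => expR (e i))).
Proof.
move=> edec a1 eK; pose f i := expR (e i); pose z := 2 * expR (- a).
have z0 : 0 < z by rewrite mulr_gt0 ?expR_gt0.
have mono : nondecreasing_seq (series f).
  by apply/nondecreasing_seqP => n; rewrite /series/= big_nat_recr//= lerDl expR_ge0.
have block k : (K <= k)%N -> series f (2 ^ k.+1)%N <= series f (2 ^ k)%N + z ^+ k.
  move=> Kk; have h2 : (2 ^ k <= 2 ^ k.+1)%N by rewrite leq_exp2l.
  rewrite /series/= (big_cat_nat (leq0n _) h2)//= lerD2l.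
  apply: (@le_trans _ _ (\sum_(2 ^ k <= i < (2 ^ k.+1)%N) expR (- a) ^+ k)).
    rewrite big_nat_cond [leRHS]big_nat_cond; apply: ler_sum => i /andP[/andP[ki _] _].
    rewrite -expRM_natl ler_expR mulrN mulrC; apply: ltW; apply: le_lt_trans (eK k Kk).
    by rewrite edec.
  by rewrite sumr_const_nat expnS mul2n -addnn addnK -mulr_natl natrX -exprMn.
have bound k : series f (2 ^ (K + k))%N <=
    series f (2 ^ K)%N + series (geometric 1 z) (K + k)%N.
  elim: k => [|k IH].
    by rewrite addn0 lerDl /series/=; apply: sumr_ge0 => i _; rewrite mul1r exprn_ge0// ltW.
  rewrite addnS; apply: le_trans (block _ (leq_addr _ _)) _.
  by rewrite /series/= big_nat_recr//= addrA mul1r lerD2r.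
have gc : cvgn (series (geometric 1 z)).
  by apply: is_cvg_geometric_series; rewrite ger0_norm// ltW.
have gmono : nondecreasing_seq (series (geometric 1 z)).
  apply/nondecreasing_seqP => n; rewrite /series/= big_nat_recr//= lerDl.
  by rewrite mul1r exprn_ge0// ltW.
apply: nondecreasing_is_cvgn => //.
exists (series f (2 ^ K)%N + limn (series (geometric 1 z))) => _ [n _ <-].
apply: (@le_trans _ _ (series f (2 ^ (K + n))%N)).
  by apply: mono; apply: ltnW; apply: leq_ltn_trans (leq_addl K n) (ltn_expl _ _).
apply: le_trans (bound n) _; rewrite lerD2l.
exact: nondecreasing_cvgn_le.
Qed.

Lemma point_count_ge (e : nat -> R) (c : R) (m : nat) : decreasing_seq e ->
  c <= e m -> (m%:R%:E <= point_count e `[c, +oo[)%E.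
Proof.
move=> edec cm; rewrite /point_count.
apply: le_trans (nneseries_lim_ge m _); last by move=> n _ _; rewrite lee_fin.
rewrite (eq_big_nat _ _ (F2 := fun=> 1%E)).
  by rewrite big_mkord sumEFin sumr_const card_ord.
move=> i /andP[_ im]; rewrite diracE mem_set//= in_itv/= andbT.
by apply: le_trans cm _; rewrite edec ltnW.
Qed.

(** The points above [L] are the first ones, so that counting them amounts to finding the
    largest label. *)
Lemma num_trapsP (e : nat -> R) (L : R) (k : nat) : decreasing_seq e ->
  (exists K, e K < L) -> (k < num_traps e L)%N = (L <= e k).
Proof.
move=> edec eL; have [n nL nmin] := ex_minnP eL.
have A i : (i < n)%N = (L <= e i).
  apply/idP/idP => [|Li].
    by apply: contraTT; rewrite -ltNge -leqNgt; exact: nmin.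
  rewrite ltnNge; apply/negP => ni; have : e i <= e n by rewrite edec.
  by rewrite leNgt => /negP; apply; exact: lt_le_trans nL Li.
suff -> : num_traps e L = n by exact: A.
rewrite /num_traps; case: n => [|n] in nL nmin A *.
  rewrite (_ : [set _ | _ in _] = set0) ?supremum0//.
  by apply/seteqP; split => // _ [i /= Li _]; rewrite -A in Li.
set B := [set _ | _ in _].
have Bn : B n.+1 by exists n => //=; rewrite -A.
rewrite /supremum ifF; last by apply/negbTE/set0P; exists n.+1.
apply: xget_unique.
  split; first by move=> _ [i /= Li <-]; rewrite -A in Li.
  by move=> y /(_ _ Bn).
move=> y [y1 y2]; apply/eqP; rewrite eq_le y1// andbT; apply: y2 => _ [i /= Li <-].
by rewrite -A in Li.
Qed.

End sparse_energies.

Section energies.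
Context {d : measure_display} {Omega : measurableType d} {R : realType}.
Context (P : probability Omega R) (E : nat -> {RV P >-> R}).

Let count (B : set R) (w : Omega) : \bar R := point_count (fun i => E i w) B.

Lemma measurable_point_count (B : set R) : measurable B -> measurable_fun setT (count B).
Proof.
move=> mB; apply: ge0_emeasurable_sum => // i _.
have -> : (fun w => \d_(E i w) B) = (fun w => (\1_(E i @^-1` B) w)%:E) :> (Omega -> \bar R).
  by apply/funext => w; rewrite diracE indicE; congr (_%:R%:E); rewrite !in_setE.
apply/measurable_EFinP/measurable_indic; rewrite -[X in measurable X]setTI.
exact: measurable_funP.
Qed.

Context (alpha : R) (alpha_gt0 : 0 < alpha).
Hypothesis E_poisson : is_poisson_process P (energy_intensity alpha)
                   (fun i => E i : Omega -> R).

(** Only the finitely many values below [m] are excluded, so that this also covers the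
    event of an infinite count. *)
Lemma tail_count_prob_le (a : R) (m : nat) : (0 < m)%N ->
  (P [set w | m%:R%:E <= count `[a, +oo[ w] <= (expR (- alpha * a) / m%:R)%:E)%E.
Proof.
move=> m0; have mB : measurable (`[a, +oo[%classic : set R) by exact: measurable_itv.
set r := expR (- alpha * a); have r0 : 0 < r by exact: expR_gt0.
have [H _ _] := E_poisson.
have PA n : P [set w | count `[a, +oo[ w = n%:R%:E] = (poisson_pmf r n)%:E.
  rewrite H// energy_intensity_tail ?ltry//= /poisson_prob r0 esum_set1// lee_fin.
  exact: poisson_pmf_ge0.
have mA n : measurable [set w | count `[a, +oo[ w = n%:R%:E].
  rewrite -[X in measurable X]setTI.
  exact: (measurable_point_count mB measurableT (emeasurable_set1 _)).
set D := [set w | _]; have mD : measurable D.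
  rewrite -[X in measurable X]setTI.
  have -> : D = count `[a, +oo[ @^-1` `[(m%:R%:E : \bar R), +oo%E].
    by apply/seteqP; split => w /=; rewrite in_itv/= ?andbT// leey andbT.
  exact: (measurable_point_count mB measurableT (emeasurable_itv _)).
pose U := \big[setU/set0]_(n < m) [set w | count `[a, +oo[ w = n%:R%:E].
have PU : P U = (\sum_(n < m) poisson_pmf r n)%:E.
  rewrite /U (measure_bigsetU_ord P xpredT)//.
    by rewrite -sumEFin; apply: eq_bigr => n _; exact: PA.
  move=> i j _ _ [w [/= -> [/eqP]]]; rewrite eqr_nat => /eqP ij.
  exact: val_inj.
have mU : measurable U by apply: bigsetU_measurable.
have DU : D `<=` ~` U.
  move=> w /= Dw.
  rewrite /U -(bigcup_mkord m (fun n => [set w | count `[a, +oo[ w = n%:R%:E])).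
  move=> -[n /= nm wn].
  by move: Dw; rewrite /D/= wn lee_fin ler_nat leqNgt nm.
apply: (@le_trans _ _ (P (~` U))).
  by apply: le_measure => //; rewrite inE//; exact: measurableC.
rewrite probability_setC// PU -EFinB lee_fin lerBlDr addrC -lerBlDr.
exact: poisson_pmf_partial_ge.
Qed.

(** Borel-Cantelli for the events that [2 ^ k] points lie above [- a k], followed by
    condensation. *)
Lemma trap_time_summable (alpha_lt1 : alpha < 1) (tau0 : R) :
  {ae P, forall w, decreasing_seq (fun i => E i w : R)} ->
  {ae P, forall w, decreasing_seq (fun i => E i w : R) /\
                   cvgn (series (trap_time tau0 (fun i => E i w)))}.
Proof.
(* [a_lo] needs a > log 2 and [a_hi] needs alpha a < log 2: take the midpoint *)
pose a := ln 2 * ((1 + alpha^-1) / 2) : R.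
have ln2 : 0 < ln 2 :> R by rewrite ln_gt0// ltr1n.
have ai : 1 < alpha^-1 by rewrite invf_gt1.
have a_lo : 2 * expR (- a) < 1.
  rewrite -[2 in X in X < _](@lnK R 2) ?posrE// -expRD expR_lt1.
  rewrite /a; nra.
pose z := expR (alpha * a) / 2.
have z0 : 0 < z by rewrite divr_gt0 ?expR_gt0.
have a_hi : z < 1.
  rewrite ltr_pdivrMr// mul1r -[ltRHS](@lnK R 2) ?posrE// ltr_expR.
  have -> : alpha * a = ln 2 * ((alpha + 1) / 2) by rewrite /a; field; rewrite gt_eqF.
  nra.
pose c k : R := - (a * k%:R).
pose B (k : nat) := [set w | ((2 ^ k)%N%:R%:E <= count `[c k, +oo[ w)%E].
have mB k : measurable (B k).
  rewrite -[X in measurable X]setTI.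
  have -> : B k = count `[c k, +oo[ @^-1` `[((2 ^ k)%N%:R%:E : \bar R), +oo%E].
    by apply/seteqP; split => w /=; rewrite in_itv/= ?andbT// leey andbT.
  have mI : measurable (`[c k, +oo[%classic : set R) by exact: measurable_itv.
  exact: (measurable_point_count mI measurableT (emeasurable_itv _)).
have PB k : (P (B k) <= (z ^+ k)%:E)%E.
  apply: le_trans (tail_count_prob_le _ _) _; first by rewrite expn_gt0.
  have -> : - alpha * c k = k%:R * (alpha * a) by rewrite /c; ring.
  by rewrite lee_fin expRM_natl natrX -exprVn -exprMn.
have P0 : P (lim_sup_set B) = 0%E.
  apply: lim_sup_set_cvg0 => //.
  apply: (@le_lt_trans _ _ (\sum_(0 <= k <oo) (z ^+ k)%:E)%E).
    by apply: lee_nneseries => // k _; exact: PB.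
  have gc : cvgn (series (geometric 1 z)).
    by apply: is_cvg_geometric_series; rewrite ger0_norm// ltW.
  have -> : (\sum_(0 <= k <oo) (z ^+ k)%:E)%E = (limn (series (geometric 1 z)))%:E.
    rewrite -EFin_lim//; apply/congr_lim/funext => n /=.
    by rewrite /series/= -sumEFin; apply: eq_bigr => i _; rewrite mul1r.
  exact: ltry.
have Bae : {ae P, forall w, ~ lim_sup_set B w}.
  exists (lim_sup_set B); split => //.
    by apply: bigcap_measurable => // k _; exact: bigcup_measurable.
  by move=> w /= /contrapT.
move=> Edec; near=> w.
have wdec : decreasing_seq (fun i => E i w : R) by near: w; exact: Edec.
have wB : ~ lim_sup_set B w by near: w; exact: Bae.
split => //.
have [K hK] : exists K, forall k, (K <= k)%N -> ~ B k w.
  apply: contrapT => H; apply: wB => K _.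
  apply: contrapT => H2; apply: H; exists K => k Kk Bk; apply: H2.
  by exists k.
have ec : cvgn (series (fun i => expR (E i w))).
  apply: (@cvgn_condensation R _ a K) => // k Kk.
  rewrite ltNge; apply/negP => h; apply: (hK k Kk); rewrite /B/=.
  exact: point_count_ge.
have -> : trap_time tau0 (fun i => E i w) = tau0^-1 *: (fun i => expR (E i w)).
  by apply/funext => i; rewrite /trap_time /trap_rate invfM -expRN opprK.
exact: is_cvg_seriesZ.
Unshelve. all: by end_near. Qed.

End energies.

(** * The trap model in a typical environment *)

Section trap_environment.
Context {R : realType} (tau0 : R) (e : nat -> R).
Hypothesis tau0_gt0 : 0 < tau0.
Hypothesis e_dec : decreasing_seq e.
Hypothesis tau_sum : cvgn (series (trap_time tau0 e)).

Lemma trap_rate_gt0 i : 0 < trap_rate tau0 e i.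
Proof. by rewrite mulr_gt0 ?expR_gt0. Qed.

Lemma trap_rate_nondecreasing : nondecreasing_seq (trap_rate tau0 e).
Proof. by move=> i j ij; rewrite ler_pM2l// ler_expR lerN2 e_dec. Qed.

Lemma trap_rate_inj : injective (trap_rate tau0 e).
Proof.
move=> i j /(mulfI (lt0r_neq0 tau0_gt0))/expR_inj/oppr_inj eij.
by apply/eqP; rewrite eqn_leq -!e_dec eij lexx.
Qed.

Lemma energies_unbounded_below (L : R) : exists K, e K < L.
Proof.
have t0 := cvg_series_cvg_0 tau_sum.
have l0 : 0 < tau0^-1 * expR L by rewrite mulr_gt0 ?expR_gt0 ?invr_gt0.
have [K _ /(_ K (leqnn K))] := cvgr_lt _ t0 _ l0.
rewrite /trap_time /trap_rate invfM -expRN opprK ltr_pM2l ?invr_gt0// ltr_expR => eK.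
by exists K.
Qed.

Lemma num_traps_homo (a b : R) : a <= b -> (num_traps e b <= num_traps e a)%N.
Proof.
move=> ab; case Nb: (num_traps e b) => [//|n].
have : (n < num_traps e b)%N by rewrite Nb.
have eb c := energies_unbounded_below c.
by rewrite !num_trapsP//; exact: le_trans.
Qed.

Lemma num_traps_unbounded K : exists L0, forall L, L <= L0 -> (K < num_traps e L)%N.
Proof.
by exists (e K) => L LK; rewrite num_trapsP//; exact: energies_unbounded_below.
Qed.

End trap_environment.

Theorem proposition4p2 (R : realType) (alpha tau0 : R)
    (d : measure_display) (Omega : measurableType d) (P : probability Omega R)
    (E : nat -> {RV P >-> R})
    (alpha_gt0 : 0 < alpha) (alpha_lt1 : alpha < 1) (tau0_gt0 : 0 < tau0)
    (E_poisson : is_poisson_process P (energy_intensity alpha)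
                   (fun i => E i : Omega -> R))
    (E_decreasing : {ae P, forall w, decreasing_seq (fun i => E i w : R)}) :
  {ae P, forall w,
    let e : nat -> R := fun i => E i w in
    let x := trap_rate tau0 e in
    let tau := trap_time tau0 e in
    forall (d' : measure_display) (T : R -> measurableType d')
      (PE : forall L : R, probability (T L) R)
      (Y : forall L : R, R -> T L -> trap e L),
    (forall L : R, is_trap_chain (PE L) tau0 (Y L)) ->
    [/\ forall j : nat,
          iterated_limit (fun L t => depth_prob (PE L) tau0 (Y L) j t)
            (tau j / limn (series tau)),
        forall theta : R, 0 < theta ->
          iterated_limit (fun L tw => no_jump_prob (PE L) (Y L) (theta * tw) tw)
            0
      & forall t : R, 0 < t ->
          iterated_limit (fun L tw => no_jump_prob (PE L) (Y L) t tw)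
            (limn (series (fun i => tau i * expR (- x i * t))) /
             limn (series tau))]}.
Proof.
apply: filterS (trap_time_summable alpha_gt0 E_poisson alpha_lt1 tau0 E_decreasing).
move=> w [e_dec tau_sum] /=; set e := fun i => E i w; set x := trap_rate tau0 e.
set tau := trap_time tau0 e => d' T PE Y HY.
pose N := num_traps e.
have x_gt0 : forall i, 0 < x i by exact: trap_rate_gt0.
have x_mono : nondecreasing_seq x by exact: trap_rate_nondecreasing.
have N_mono a b : a <= b -> (N b <= N a)%N.
  by move=> ab; exact: (num_traps_homo tau0_gt0 e_dec tau_sum).
have N_infty K : exists L0, forall L, L <= L0 -> (K < N L)%N.
  exact: (num_traps_unbounded tau0_gt0 e_dec tau_sum).
have N_near K : \forall L \near -oo, (K < N L)%N.
  have [L0 h] := N_infty K; near=> L; apply: h.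
  by near: L; apply: nbhs_ninfty_le; exact: num_real.
pose chain_flow (L : R) (pL : nat -> R -> R) := (0 < N L)%N ->
  [/\ trap_flow x (N L) pL,
      forall (i : trap e L) (t : R), 0 <= t ->
        PE L (Y L t @^-1` [set i]) = (pL i t)%:E
    & forall tw t : R, 0 <= tw -> 0 < t -> no_jump_prob (PE L) (Y L) t tw =
        \sum_(i < N L) pL i tw * expR (- (x i * (1 - (N L)%:R^-1) * t))].
have [p Hp] : exists p, forall L, chain_flow L (p L).
  suff /choice[p Hp] : forall L, exists pL, chain_flow L pL by exists p.
  move=> L; have [N0|N0] := ltnP 0 (N L); last first.
    by exists (fun _ _ => 0); rewrite /chain_flow ltnNge N0.
  by have [pL HpL] := trap_chain_flow N0 (HY L); exists pL.
have pF L : (0 < N L)%N -> trap_flow x (N L) (p L) by move=> /Hp[].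
have no_jump_cvg tw t : 0 <= tw -> 0 < t ->
    no_jump_prob (PE L) (Y L) t tw @[L --> -oo] --> limit_no_jump x p t tw.
  move=> tw0 t0.
  have [_ h] := cvg_no_jump x_gt0 x_mono tau_sum N_mono N_infty pF t0 tw0.
  apply: cvg_trans h; apply: near_eq_cvg; near=> L.
  have N0 : (0 < N L)%N by near: L; exact: N_near.
  by have [_ _ ->] := Hp L N0.
split.
- move=> j; exists (limit_law p j); last first.
    exact: (limit_law_cvg x_gt0 x_mono tau_sum N_mono N_infty pF).
  move=> t t0.
  have h : p L j t @[L --> -oo] --> limit_law p j t.
    exact: (cvg_limit_law x_gt0 N_mono N_infty pF).
  apply: cvg_trans h; apply: near_eq_cvg; near=> L.
  have jN : (j < N L)%N by near: L; exact: N_near.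
  have N0 : (0 < N L)%N by exact: leq_ltn_trans jN.
  have [_ pE _] := Hp L N0.
  have jN' : (j < (N L).-1.+1)%N by rewrite prednK.
  rewrite /depth_prob (_ : [set w | _] = Y L t @^-1` [set Ordinal jN']) ?pE//.
  apply/seteqP; split => v /=; last by move=> ->.
  by move=> /(trap_rate_inj tau0_gt0 e_dec) vj; exact: val_inj.
- move=> theta theta0.
  (* At tw = 0 the time window is a single point, and staying there is certain. *)
  exists (fun tw => if tw == 0 then 1 else limit_no_jump x p (theta * tw) tw).
    move=> tw; rewrite le_eqVlt => /predU1P[<-|tw0]; last first.
      by rewrite gt_eqF//; apply: no_jump_cvg; rewrite ?mulr_gt0// ltW.
    rewrite eqxx mulr0.
    rewrite (_ : (fun L => _) = fun=> 1); first exact: cvg_cst.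
    apply/funext => L.
    rewrite /no_jump_prob (_ : [set w | _] = setT) ?probability_setT//.
    apply/seteqP; split => // v _ s; rewrite addr0 => s0.
    by rewrite (le_anti s0).
  have h := limit_no_jump_aging x_gt0 x_mono tau_sum N_mono N_infty pF theta0.
  apply: cvg_trans h; apply: near_eq_cvg; near=> tw.
  by rewrite gt_eqF//; near: tw; apply: nbhs_pinfty_gt; exact: num_real.
- move=> t t0; exists (limit_no_jump x p t) => [tw tw0|]; first exact: no_jump_cvg.
  exact: (limit_no_jump_equilibrium x_gt0 x_mono tau_sum N_mono N_infty pF).
Unshelve. all: by end_near. Qed.
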